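(* Let $p\ge 3$ be a prime, let $N$ be a positive integer coprime to $p$, and let $\alpha\ge 0$ be an integer. (1) For every integer $n\ge 0$, $\overline{p}_3(11^3 n)\equiv \overline{p}_3(11n)\pmod{11}$. (2) If $p\equiv 1,3,4,5,9\pmod{11}$, then $\overline{p}_3(11p^{22\alpha+21}N)\equiv 0\pmod{11}$. (3) If $p\equiv 2,6,7,8,10\pmod{11}$, then $\overline{p}_3(11p^{4\alpha+3}N)\equiv 0\pmod{11}$.
   Context: An overpartition of $n$ is a partition of $n$ in which the first occurrence of each distinct part may (or may not) be overlined. An overpartition triple of $n$ is a triple of overpartitions whose parts together sum to $n$. $\overline{p}_3(n)$ denotes the number of overpartition triples of $n$, with $\overline{p}_3(0)=1$; equivalently $\sum_{n\ge0}\overline{p}_3(n)q^n=\big((-q;q)_\infty/(q;q)_\infty\big)^3$, where $(a;q)_\infty=\prod_{n\ge0}(1-aq^n)$. *)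

(* Defs.v *)
From mathcomp Require Import all_boot.

Set Implicit Arguments.
Unset Strict Implicit.
Unset Printing Implicit Defensive.

(** A partition whose parts may carry a mark is the list of its parts in
    nonincreasing order, each paired with a boolean telling whether that
    occurrence of the part is overlined. *)
Definition marked_parts := seq (nat * bool).

(** In the last clause, the [i]-th entry is the first occurrence of its part
    exactly when that part is absent from the first [i] entries. *)
Definition overpartition (s : marked_parts) : bool :=
  [&& sorted geq (unzip1 s), 0 \notin unzip1 s &
      [forall i : 'I_(size s),
        (nth (0, false) s i).2 ==>
        ((nth (0, false) s i).1 \notin unzip1 (take i s))]].

Definition weight (s : marked_parts) : nat := sumn (unzip1 s).

Definition overpartition_triple (n : nat)
    (t : marked_parts * marked_parts * marked_parts) : bool :=
  let: (a, b, c) := t in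
  [&& overpartition a, overpartition b, overpartition c &
      weight a + weight b + weight c == n].

(** An overpartition occurring in a triple of [n] has at most [n] parts, each
    at most [n], so triples of [n] can be counted inside a finite type;
    [pbar3_enum] below shows that these bounds lose nothing. *)
Definition bounded_marked_parts (n : nat) := n.-bseq ('I_n.+1 * bool).

Definition unbound (n : nat) (s : bounded_marked_parts n) : marked_parts :=
  [seq (val x.1, x.2) | x <- s].

Definition unbound3 (n : nat)
    (t : bounded_marked_parts n * bounded_marked_parts n
         * bounded_marked_parts n) :=
  (unbound t.1.1, unbound t.1.2, unbound t.2).

Definition pbar3 (n : nat) : nat :=
  #|[set t : bounded_marked_parts n * bounded_marked_parts n
             * bounded_marked_parts n
    | overpartition_triple n (unbound3 t)]|.

Lemma unbound_inj n : injective (@unbound n).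
Proof.
move=> s t est; apply: val_inj; apply: (inj_map _ est).
by move=> [i b] [j c] /= [/val_inj -> ->].
Qed.

Lemma unbound3_inj n : injective (@unbound3 n).
Proof.
by move=> [[a b] c] [[a' b'] c'] [/unbound_inj -> /unbound_inj -> /unbound_inj ->].
Qed.

Lemma size_le_sumn (s : seq nat) : 0 \notin s -> size s <= sumn s.
Proof.
elim: s => //= x s IHs; rewrite in_cons negb_or => /andP[x0 /IHs le_s].
by rewrite -add1n leq_add // lt0n eq_sym.
Qed.

Lemma mem_le_sumn (s : seq nat) x : x \in s -> x <= sumn s.
Proof.
elim: s => //= y s IHs; rewrite in_cons => /orP[/eqP -> | /IHs le_x].
  exact: leq_addr.
exact: leq_trans le_x (leq_addl _ _).
Qed.

Lemma unbound_surj n (s : marked_parts) :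
  overpartition s -> weight s <= n -> exists u, @unbound n u = s.
Proof.
move=> /and3P[_ s0 _] le_n.
have sz : size [seq (inord x.1 : 'I_n.+1, x.2) | x <- s] <= n.
  by rewrite size_map -(size_map fst); apply: leq_trans (size_le_sumn s0) le_n.
exists (Bseq sz); rewrite /unbound /= -map_comp -[RHS]map_id.
apply/eq_in_map => -[x b] xs /=; rewrite inordK //.
by rewrite ltnS; apply: leq_trans (mem_le_sumn _) le_n; apply: (map_f fst xs).
Qed.

(** [pbar3 n] is the length of any duplicate-free list of all overpartition
    triples of [n]. *)
Lemma pbar3_enum n (l : seq (marked_parts * marked_parts * marked_parts)) :
  uniq l -> (forall t, (t \in l) = overpartition_triple n t) ->
  pbar3 n = size l.
Proof.
move=> Ul lE; rewrite /pbar3 cardE -(size_map (@unbound3 n)).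
apply/perm_size/uniq_perm => //.
  by rewrite (map_inj_uniq (@unbound3_inj n)) enum_uniq.
move=> t; rewrite lE; apply/mapP/idP => [[u] | tP].
  by rewrite mem_enum inE => ? ->.
case: t tP => [[a b] c] tP; have /and4P[aP bP cP /eqP sum_n] := tP.
have [|u ua] := @unbound_surj n a aP; first by rewrite -sum_n -addnA leq_addr.
have [|v vb] := @unbound_surj n b bP.
  by rewrite -sum_n addnAC leq_addl.
have [|w wc] := @unbound_surj n c cP; first by rewrite -sum_n leq_addl.
exists (u, v, w); last by rewrite /unbound3 /= ua vb wc.
by rewrite mem_enum inE /unbound3 /= ua vb wc.
Qed.

(* Main.v *)
Require Import Defs.
From HB Require Import structures.
From Stdlib Require Import Classical.
From mathcomp Require Import all_boot all_order all_fingroup all_solvable all_algebra.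
From mathcomp Require Import ring lra zify.

(** Write r_k(m) for the number of vectors of norm m in Z^k and phi(-q) for the
    sum of (-1)^j q^(j^2) over all integers j.  By Gauss, overpartitions have
    generating function 1/phi(-q), so modulo 11 overpartition triples have
    generating function phi(-q)^8 / phi(-q^11).  Since r_8(11m) = r_8(m) mod 11,
    extracting the exponents divisible by 11 leaves phi(-q)^8 / phi(-q), that is
    pbar3(11n) = (-1)^n r_7(n) mod 11.  The three claims then follow from the
    relation r_7(p^2 m) + p^5 r_7(m/p^2) = (1 + p^5) r_7(m), valid when p divides m,
    and from r_7(121 m) = r_7(m) mod 11.

    Both facts about r_7 and r_8 come from lattices.  For k <= 8, an odd
    unimodular lattice K in Q^k such that K/(K meet Z^k) is cyclic is isometric to
    Z^k: if d is the order of this quotient and w a generator, some l in Z^k is so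
    close to w that the reflection in w - l decreases d.  Hence all p-neighbors of
    Z^k attached to isotropic vectors modulo p have r_k(m) vectors of norm m, and
    counting these vectors over a whole family of neighbors relates r_k(p^2 m) to
    r_k(m).  For r_7 take all isotropic lines; for r_8 take the lines of a
    4-dimensional isotropic subspace which is the image modulo 11 of a similarity
    of Z^8 of ratio 11. *)

Set Implicit Arguments.
Unset Strict Implicit.
Unset Printing Implicit Defensive.
Import Order.TTheory GRing.Theory Num.Theory.
Local Open Scope ring_scope.

(** * Lattices with cyclic quotient over Z^n *)

Definition dotp (R : pzRingType) (n : nat) (x y : 'rV[R]_n) : R :=
  \sum_i x 0 i * y 0 i.

Section Dot.
Variables (R : comPzRingType) (n : nat).
Implicit Types x y z : 'rV[R]_n.

Lemma dotpC x y : dotp x y = dotp y x.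
Proof. by apply: eq_bigr => i _; rewrite mulrC. Qed.

Lemma dotpDl x y z : dotp (x + y) z = dotp x z + dotp y z.
Proof. by rewrite /dotp -big_split; apply: eq_bigr => i _; rewrite mxE mulrDl. Qed.

Lemma dotpZl a x y : dotp (a *: x) y = a * dotp x y.
Proof. by rewrite /dotp mulr_sumr; apply: eq_bigr => i _; rewrite mxE mulrA. Qed.

Lemma dotpDr x y z : dotp z (x + y) = dotp z x + dotp z y.
Proof. by rewrite !(dotpC z) dotpDl. Qed.

Lemma dotpZr a x y : dotp x (a *: y) = a * dotp x y.
Proof. by rewrite !(dotpC x) dotpZl. Qed.

Lemma dotpNl x y : dotp (- x) y = - dotp x y.
Proof. by rewrite -scaleN1r dotpZl mulN1r. Qed.

Lemma dotpNr x y : dotp x (- y) = - dotp x y.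
Proof. by rewrite !(dotpC x) dotpNl. Qed.

Lemma dotpBl x y z : dotp (x - y) z = dotp x z - dotp y z.
Proof. by rewrite dotpDl dotpNl. Qed.

Lemma dotpBr x y z : dotp z (x - y) = dotp z x - dotp z y.
Proof. by rewrite dotpDr dotpNr. Qed.

Lemma dotp0l x : dotp 0 x = 0.
Proof. by rewrite /dotp big1 // => i _; rewrite mxE mul0r. Qed.

Lemma dotp0r x : dotp x 0 = 0.
Proof. by rewrite dotpC dotp0l. Qed.

Lemma dotp_delta x j : dotp x (delta_mx 0 j) = x 0 j.
Proof.
rewrite /dotp (bigD1 j) //= mxE !eqxx mulr1 big1 ?addr0 // => i /negPf ij.
by rewrite mxE ij andbF mulr0.
Qed.
End Dot.

Definition dotpE := (dotpDl, dotpDr, dotpNl, dotpNr, dotpZl, dotpZr).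

Section Lattice.
Variable n : nat.
Notation V := 'rV[rat]_n.
Implicit Types (x y z u w l : V) (K : V -> Prop).

Definition integral x := [forall i, x 0 i \is a Num.int].
Notation L := integral.

Lemma integralP x : reflect (forall i, x 0 i \is a Num.int) (L x).
Proof. exact: forallP. Qed.

Lemma integralD x y : L x -> L y -> L (x + y).
Proof.
by move=> /integralP Lx /integralP Ly; apply/integralP => i; rewrite mxE rpredD.
Qed.

Lemma integralZ a x : a \is a Num.int -> L x -> L (a *: x).
Proof. by move=> Ia /integralP Lx; apply/integralP => i; rewrite mxE rpredM. Qed.

Lemma integralN x : L x -> L (- x).
Proof. by rewrite -scaleN1r; apply: integralZ. Qed.

Lemma integralB x y : L x -> L y -> L (x - y).
Proof. by move=> Lx Ly; rewrite integralD ?integralN. Qed.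

Lemma integral0 : L 0.
Proof. by apply/integralP => i; rewrite mxE. Qed.

Lemma dotp_int x y : L x -> L y -> dotp x y \is a Num.int.
Proof. by move=> /integralP Lx /integralP Ly; apply: rpred_sum => i _; apply: rpredM. Qed.

Lemma delta_integral j : L (delta_mx 0 j).
Proof. by apply/integralP => i; rewrite mxE; case: (_ && _). Qed.

(** The equivalence already makes K a group on which the form is integral; [selfdual0], [selfdualB]
    and [selfdualZ] extract this. *)
Definition selfdual K :=
  forall y, K y <-> (forall x, K x -> dotp x y \is a Num.int).

Definition odd_lattice K := exists x (c : int), K x /\ dotp x x = (2 * c + 1)%:~R.

(** Neither w in K nor minimality of d is demanded, because the reflection step below produces data
    of this weaker kind. *)
Definition cyclic_over K w (d : nat) :=
  [/\ (0 < d)%N, L (d%:R *: w) &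
      forall x, K x -> exists k : int, L (x - k%:~R *: w)].

Section Selfdual.
Variable K : V -> Prop.
Hypothesis Ksd : selfdual K.

Lemma selfdual_dot x y : K x -> K y -> dotp x y \is a Num.int.
Proof. by move=> Kx /Ksd; apply. Qed.

Lemma selfdual0 : K 0.
Proof. by apply/Ksd => x _; rewrite dotp0r. Qed.

Lemma selfdualB x y : K x -> K y -> K (x - y).
Proof.
move=> Kx Ky; apply/Ksd => z Kz; rewrite dotpBr.
by rewrite rpredB // selfdual_dot.
Qed.

Lemma selfdualZ a x : a \is a Num.int -> K x -> K (a *: x).
Proof.
move=> Ia Kx; apply/Ksd => z Kz; rewrite dotpZr.
by rewrite rpredM // selfdual_dot.
Qed.

Lemma selfdual_integral : (forall x, K x -> L x) ->
  forall x, K x <-> L x.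
Proof.
move=> KL x; split; first exact: KL.
by move=> Lx; apply/Ksd => y /KL Ly; apply: dotp_int.
Qed.

(* The multiples j of w that occur modulo Z^n in K form a subgroup of Z; the
   lift to K of its positive generator replaces w. *)
Lemma cyclic_over_generator w d : cyclic_over K w d ->
  exists2 w', K w' & cyclic_over K w' d.
Proof.
case=> d0 dw Kw.
pose P j := (0 < j)%N /\ exists2 x, K x & L (x - j%:R *: w).
have Pd : P d.
  by split=> //; exists 0; [exact: selfdual0 | rewrite sub0r integralN].
have [j [Pj jmin]] : exists j, P j /\ forall i, P i -> (j <= i)%N.
  elim/ltn_ind: d {d0 dw} Pd => i IH Pi.
  case: (classic (exists2 j, P j & (j < i)%N)) => [[j Pj ji]|no].
    exact: IH ji Pj.
  exists i; split=> // j Pj; rewrite leqNgt; apply/negP => ji.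
  by apply: no; exists j.
have [j0 [w' Kw' Lw']] := Pj.
exists w' => //; split=> //.
  have -> : d%:R *: w' = d%:R *: (w' - j%:R *: w) + j%:R *: (d%:R *: w).
    by rewrite scalerBr !scalerA mulrC subrK.
  by rewrite integralD // integralZ // rpred_nat.
move=> x Kx; have [k Lk] := Kw x Kx.
pose q := (k %/ j)%Z; pose r := `|(k %% j)%Z|%N.
have kE : (k%:~R : rat) = q%:~R * j%:R + r%:R.
  have jn0 : j%:Z != 0 by rewrite eqz_nat -lt0n.
  rewrite -[r%:R]/((r%:Z)%:~R) -[j%:R]/((j%:Z)%:~R) -intrM -intrD.
  by rewrite /r gez0_abs ?modz_ge0 // -divz_eq.
have rj : (r < j)%N.
  rewrite -ltz_nat /r gez0_abs ?modz_ge0 ?ltz_pmod //.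
  by rewrite eqz_nat -lt0n.
have Lr : L (x - q%:~R *: w' - r%:R *: w).
  have -> : x - q%:~R *: w' - r%:R *: w
     = (x - k%:~R *: w) - q%:~R *: (w' - j%:R *: w).
    by apply/rowP => i; rewrite !mxE kE; ring.
  by rewrite integralB // integralZ // intr_int.
exists q; have [r0|r0] := posnP r; first by rewrite r0 scale0r subr0 in Lr.
have: P r.
  split=> //; exists (x - q%:~R *: w') => //.
  by apply: selfdualB => //; apply: selfdualZ => //; apply: intr_int.
by move/jmin; rewrite leqNgt rj.
Qed.

End Selfdual.

(* Round every coordinate to a nearest integer; if the norm of the result has
   the wrong parity, move the coordinate with the largest rounding error a to
   the next nearest integer, at squared distance at most 7a^2 + (1-a)^2. *)
Lemma covering w (c : int) : (0 < n <= 8)%N ->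
  ~ (n = 8 /\ forall i, w 0 i - 2^-1 \is a Num.int) ->
  exists l (e : int), [/\ L l, dotp l l + c%:~R = (2 * e)%:~R &
    dotp (w - l) (w - l) < 2].
Proof.
move=> /andP[n0 n8] nhalf.
pose l0 : V := \row_i (Num.floor (w 0 i + 2^-1))%:~R.
pose dl i := w 0 i - l0 0 i.
have dl_ge i : - 2^-1 <= dl i.
  by have := floor_le_tmp (w 0 i + 2^-1); rewrite /dl mxE; lra.
have dl_lt i : dl i < 2^-1.
  by have := floorD1_gt (w 0 i + 2^-1); rewrite /dl mxE intrD; lra.
have dl2 i : dl i ^+ 2 <= 4^-1.
  by have := dl_ge i; have := dl_lt i; nra.
have Ll0 : L l0 by apply/integralP => i; rewrite mxE intr_int.
have dotE l : dotp (w - l) (w - l) = \sum_i (w 0 i - l 0 i) ^+ 2.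
  by apply: eq_bigr => i _; rewrite !mxE expr2.
have bound k b : (forall j, dl j ^+ 2 <= b) ->
    \sum_(j | j != k) dl j ^+ 2 <= (n.-1)%:R * b.
  move=> db; apply: le_trans (_ : \sum_(j | j != k) b <= _).
    by apply: ler_sum => j _.
  rewrite sumr_const -[X in _ *+ X]/(#|predC1 k|) cardC1 card_ord.
  by rewrite mulr_natl.
have n1_le : (n.-1)%:R <= 7 :> rat by rewrite (ler_nat _ _ 7); lia.
have lt2 : \sum_i dl i ^+ 2 < 2.
  (* Each squared error is at most 1/4, so the sum reaches 2 only for n = 8 with every error equal
     to -1/2, which is the excluded case. *)
  have [k hk] : exists k, dl k ^+ 2 + (n.-1)%:R / 4 < 2.
    have [n7|n7] := ltnP n 8.
      have n1_le6 : (n.-1)%:R <= 6 :> rat by rewrite (ler_nat _ _ 6); lia.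
      by exists (Ordinal n0); have := dl2 (Ordinal n0); lra.
    have [k hk] : exists k, w 0 k - 2^-1 \isn't a Num.int.
      apply/existsP; rewrite -[X in is_true X]negbK negb_exists.
      apply/negP => /forallP h.
      by apply: nhalf; split; [lia | move=> i; have := h i; rewrite negbK].
    exists k; suff : dl k != - 2^-1 by have := dl_ge k; have := dl_lt k; nra.
    apply: contra hk => /eqP dk.
    have -> : w 0 k - 2^-1 = l0 0 k - 1 by move: dk; rewrite /dl; lra.
    by rewrite mxE rpredB ?intr_int.
  rewrite (bigD1 k) //=; apply: le_lt_trans hk.
  by rewrite lerD2l; apply: bound.
have [D HD] : exists D : int, dotp l0 l0 = D%:~R.
  exact/intrP/dotp_int.
have [e [He|He]] : exists e : int, D + c = 2 * e \/ D + c = 2 * e + 1.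
  exists ((D + c) %/ 2)%Z.
  have := divz_eq (D + c) 2; have := ltz_pmod (D + c) (isT : 0 < 2%:Z).
  have := modz_ge0 (D + c) (isT : 2%:Z != 0).
  lia.
  exists l0, e; split=> //; first by rewrite HD -intrD He.
  by rewrite dotE.
clearbody l0.
have [i _ imax] := @arg_maxP _ _ _ (Ordinal n0) xpredT (fun i => `|dl i|) isT.
have dmax j : dl j ^+ 2 <= dl i ^+ 2.
  rewrite -(real_normK (num_real (dl j))) -(real_normK (num_real (dl i))).
  by apply: lerXn2r; rewrite ?nnegrE ?normr_ge0 //; apply: imax.
(* Moving in the direction of the rounding error turns its absolute value a into 1 - a and flips the
   parity of the norm. *)
pose s : int := if 0 <= dl i then 1 else -1.
have [t Ht] : exists t : int, l0 0 i = t%:~R by apply/intrP/integralP.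
exists (l0 + s%:~R *: delta_mx 0 i), (e + 1 + s * t); split.
- by rewrite integralD // integralZ ?intr_int // delta_integral.
- rewrite !dotpE !(dotpC (delta_mx _ _)) !dotp_delta Ht HD mxE !eqxx mulr1.
  have s2 : (s%:~R : rat) * s%:~R = 1 by rewrite /s; case: ifP.
  rewrite s2 !(mulrDr, intrD, intrM).
  have := congr1 (fun z : int => z%:~R : rat) He.
  rewrite /= !(intrD, intrM) => He'; lra.
rewrite dotE (bigD1 i) //= !mxE !eqxx mulr1.
under eq_bigr => j ji do rewrite !mxE (negPf ji) andbF mulr0 addr0.
move: lt2; rewrite (bigD1 i) //= => lt2.
have b2 := bound i _ dmax.
have E : (w 0 i - (l0 0 i + s%:~R)) ^+ 2 = (1 - `|dl i|) ^+ 2.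
  by rewrite /s /dl; case: (ger0P (w 0 i - l0 0 i)) => _; ring.
rewrite E.
have a0 := normr_ge0 (dl i).
have aE : dl i ^+ 2 = `|dl i| ^+ 2 by rewrite real_normK ?num_real.
have a1 : `|dl i| <= 2^-1 by rewrite ler_norml dl_ge ltW.
move: lt2 b2; rewrite -/(dl _) aE; move: `|dl i| a0 a1 => a a0 a1.
rewrite -[X in _ -> _ -> _ + X < _]/(\sum_(j | j != i) dl j ^+ 2).
move: (\sum_(j | j != i) _) => S lt2 b2.
(* For a = 1/2 the sum of squares is unchanged by the move; for a < 1/2, 7a^2 + (1-a)^2 - 2 =
   (4a+1)(2a-1) < 0. *)
have [a2|a2] := eqVneq a 2^-1; first by move: lt2; rewrite a2; lra.
have a3 : a < 2^-1 by rewrite lt_neqAle a2.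
have b3 : S <= 7 * a ^+ 2 by apply: le_trans b2 _; rewrite ler_wpM2r ?exprn_ge0.
nra.
Qed.

Lemma int_bin2 (t : rat) : t \is a Num.int -> t * (t - 1) / 2 \is a Num.int.
Proof.
move=> /intrP[k ->].
have [e [->|->]] : exists e : int, k = 2 * e \/ k = 2 * e + 1.
  exists (k %/ 2)%Z; have := divz_eq k 2.
  have := ltz_pmod k (isT : 0 < 2%:Z); have := modz_ge0 k (isT : 2%:Z != 0).
  lia.
- have -> : (2 * e)%:~R * ((2 * e)%:~R - 1) / 2 = (e * (2 * e - 1))%:~R :> rat.
    by rewrite !(intrM, intrB); field.
  exact: intr_int.
- have -> : (2 * e + 1)%:~R * ((2 * e + 1)%:~R - 1) / 2
      = (e * (2 * e + 1))%:~R :> rat.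
    by rewrite !(intrM, intrB, intrD); field.
  exact: intr_int.
Qed.

(* If w is half-integral in dimension 8, then K is the E8 lattice, which is even. *)
Lemma odd_lattice_not_half K w d : selfdual K -> odd_lattice K -> K w ->
  cyclic_over K w d -> ~ (n = 8 /\ forall i, w 0 i - 2^-1 \is a Num.int).
Proof.
move=> Ksd [x [a [Kx xx]]] Kw [_ _ Kcyc] [n8 hw].
have [k Lz] := Kcyc x Kx; set z := x - _ in Lz.
have xE : x = k%:~R *: w + z by rewrite addrC subrK.
have zi := integralP _ Lz.
pose h : V := \row_i (w 0 i - 2^-1).
have Lh : L h by apply/integralP => i; rewrite mxE.
have zw : dotp z w \is a Num.int.
  rewrite /z dotpBl dotpZl rpredB ?rpredM ?intr_int //;
  by apply: selfdual_dot Ksd _ _ _ _.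
(* Since w_i = h_i + 1/2, the norm of w is the sum of the even numbers h_i (h_i + 1), plus 8/4 =
   2. *)
have wE : dotp w w / 2 \is a Num.int.
  have -> : dotp w w / 2 = \sum_i (- h 0 i) * (- h 0 i - 1) / 2 + 1.
    rewrite -!mulr_suml.
    have -> : dotp w w = \sum_i ((- h 0 i) * (- h 0 i - 1) + 4^-1).
      by apply: eq_bigr => i _; rewrite !mxE; field.
    have nE : n%:R = 8 :> rat by rewrite n8.
    by rewrite big_split /= sumr_const card_ord -[4^-1 *+ n]mulr_natl nE; field.
  rewrite rpredD // rpred_sum // => i _; apply: int_bin2.
  by rewrite rpredN (integralP _ Lh).
(* All entries of w - h are 1/2, so z.(w - h) is half the sum of the z_i, which differs from z.z/2
   by an integer. *)
have zE : dotp z z / 2 \is a Num.int.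
  have -> : dotp z z / 2 =
      \sum_i (z 0 i * (z 0 i - 1) / 2) + (dotp z w - dotp z h).
    rewrite -dotpBr.
    have -> : w - h = \row_i 2^-1 by apply/rowP => i; rewrite !mxE; ring.
    rewrite /dotp mulr_suml -big_split /=.
    by apply: eq_bigr => i _; rewrite mxE; field.
  apply: rpredD; last by rewrite rpredB // dotp_int.
  by apply: rpred_sum => i _; apply: int_bin2.
clearbody z.
have : dotp x x / 2 \is a Num.int.
  have -> : dotp x x / 2
      = k%:~R ^+ 2 * (dotp w w / 2) + k%:~R * dotp z w + dotp z z / 2.
    by rewrite xE !dotpE (dotpC w z); field.
  by rewrite rpredD // rpredD // rpredM ?rpredX ?intr_int.
move=> /intrP[b]; rewrite xx => E.
have : (2 * a + 1)%:~R = (2 * b)%:~R :> rat by rewrite [RHS]intrM -E; field.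
by move/intr_inj; lia.
Qed.

(* Reflecting K in u = w - l, of half-norm m/d < 1, replaces the bound d on the
   order of K over Z^n by m. *)
Lemma cyclic_descent K w d : (0 < n <= 8)%N -> selfdual K -> odd_lattice K ->
    K w -> cyclic_over K w d -> ~~ L w ->
  exists (s : V -> V) (w' : V) (m : nat),
    [/\ involutive s, forall x y, dotp (s x) (s y) = dotp x y,
      (m < d)%N & cyclic_over (K \o s) w' m].
Proof.
move=> n8 Ksd Kodd Kw Kcyc Lw.
have [c wc] := intrP (selfdual_dot Ksd Kw Kw).
have [l [e [Ll le ul]]] := covering c n8 (odd_lattice_not_half Ksd Kodd Kw Kcyc).
have [d0 dw Kw'] := Kcyc.
have [u uE] : exists u, u = w - l by exists (w - l).
rewrite -uE in ul; pose N : rat := dotp u u / 2.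
have NE : N = e%:~R - dotp w l.
  have := congr1 (fun a : rat => a / 2) le; rewrite /= intrM mulrAC divff // mul1r.
  by move=> <-; rewrite /N uE !dotpE wc (dotpC l w); field.
have dot_ge0 x : 0 <= dotp x x.
  by apply: sumr_ge0 => i _; rewrite -expr2 sqr_ge0.
have N_gt0 : 0 < N.
  rewrite /N divr_gt0 // lt0r dot_ge0 andbT.
  apply: contra Lw => /eqP/psumr_eq0P uu0.
  suff : u = 0 by rewrite uE => /subr0_eq ->.
  apply/rowP => i; rewrite [RHS]mxE; apply/eqP; rewrite -sqrf_eq0 expr2.
  by rewrite uu0 // => j _; rewrite -expr2 sqr_ge0.
have N_neq0 : N != 0 by rewrite gt_eqF.
have N_lt1 : N < 1 by rewrite /N ltr_pdivrMr // mul1r.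
(* d N = d e - (d w).l is an integer because d w and l are integral. *)
have [m mE] : exists m : nat, d%:R * N = m%:R.
  apply/natrP; rewrite natrEint mulr_ge0 ?ler0n ?ltW // andbT.
  rewrite NE mulrBr -dotpZl rpredB ?rpredM ?intr_int ?natr_int //.
  exact: dotp_int.
have uu : dotp u u = 2 * N by rewrite /N; field.
pose s x := x - (dotp x u / N) *: u.
have sK : involutive s.
  move=> x; rewrite {1}/s; have -> : dotp (s x) u = - dotp x u.
    by rewrite /s !dotpE uu; field.
  by rewrite mulNr scaleNr opprK subrK.
exists s, (N^-1 *: u), m; split=> //.
- by move=> x y; rewrite /s !dotpE uu (dotpC u y); field.
- by rewrite -(ltr_nat rat) -mE gtr_pMr // ltr0n.
split.
- by rewrite -(ltr_nat rat) -mE mulr_gt0 // ltr0n.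
- by rewrite scalerA -mE mulfK // uE scalerBr integralB // integralZ // natr_int.
(* Write s x = z + k w with z integral. Applying s again gives x = z + k l + (j/N) u with j = k N -
   (s x).u, and j = k e - w.(s x) + z.l is an integer. *)
move=> x /= Kx; have [k Lz] := Kw' _ Kx; set z := s x - _ in Lz.
have [j jE] : exists j : int, k%:~R * N - dotp (s x) u = j%:~R.
  apply/intrP.
  have -> : k%:~R * N - dotp (s x) u = k%:~R * e%:~R - dotp w (s x) + dotp z l.
    rewrite NE /z uE; move: (s x) => y.
    by rewrite !dotpE (dotpC y w) (dotpC w y); ring.
  rewrite rpredD ?dotp_int // rpredB ?rpredM ?intr_int //.
  exact: (selfdual_dot Ksd).
exists j; have -> : x - j%:~R *: (N^-1 *: u) = z + k%:~R *: l.
  rewrite -{1}(sK x) -jE {1}/s /z.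
  by rewrite uE; move: (s x) => y; apply/rowP => i; rewrite !mxE; field.
by rewrite integralD // integralZ // intr_int.
Qed.

(** Strong induction on d. If the generator is integral, then K lies in Z^n and self-duality gives
    equality; otherwise a reflection lowers d, and the isometries are composed. *)
Theorem cyclic_neighbor_isometric K w d : (0 < n <= 8)%N ->
    selfdual K -> odd_lattice K -> cyclic_over K w d ->
  exists f : V -> V, [/\ bijective f, forall x, dotp (f x) (f x) = dotp x x &
    forall x, K x <-> L (f x)].
Proof.
move=> n8; elim/ltn_ind: d K w => d IH K w Ksd Kodd.
move=> /(cyclic_over_generator Ksd) [{}w Kw Kcyc].
have [Lw|Lw] := boolP (L w).
  exists id; split=> //; first exact: inv_bij.
  apply: (selfdual_integral Ksd) => x Kx.
  have [_ _ /(_ x Kx) [k Lxk]] := Kcyc.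
  by rewrite -(subrK (k%:~R *: w) x) integralD // integralZ // intr_int.
have [s [w' [m [sK sdot md scyc]]]] := cyclic_descent n8 Ksd Kodd Kw Kcyc Lw.
have sdot' x y : dotp (s x) y = dotp x (s y) by rewrite -{1}(sK y) sdot.
have Ksd' : selfdual (K \o s).
  move=> y; split=> /= [/Ksd h x /h|h]; first by rewrite sdot.
  by apply/Ksd => x Kx; rewrite -sdot'; apply: h; rewrite sK.
have Kodd' : odd_lattice (K \o s).
  by have [x [c [Kx xx]]] := Kodd; exists (s x), c; rewrite /= sK sdot.
have [f [fbij fdot fK]] := IH m md _ _ Ksd' Kodd' scyc.
exists (f \o s); split.
- exact: bij_comp fbij (inv_bij sK).
- by move=> x /=; rewrite fdot sdot.
- by move=> x /=; rewrite -fK /= sK.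
Qed.
End Lattice.

(** * Counting vectors in p-neighbors *)

Lemma Posz_sqrM (p m : nat) : (p ^ 2 * m)%N%:Z = p%:Z ^+ 2 * m%:Z.
Proof. by rewrite PoszM -mulnn PoszM expr2. Qed.

Lemma dotp_map (R S : comPzRingType) (f : {rmorphism R -> S}) n (x y : 'rV[R]_n) :
  dotp (map_mx f x) (map_mx f y) = f (dotp x y).
Proof.
by rewrite /dotp rmorph_sum; apply: eq_bigr => i _; rewrite !mxE rmorphM.
Qed.

Section Shell.
Variable n : nat.

(** Functions into {0, ..., 2N}, shifted by N, encode the integer vectors with entries in
    [-N, N]. *)
Definition box_vec N (f : {ffun 'I_n -> 'I_(N.*2.+1)}) : 'rV[int]_n :=
  \row_i ((f i)%:Z - N%:Z).

(** The box size N is kept apart from the norm m so that one box serves all norms up to N: an entry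
    a of a vector of norm m satisfies |a| <= a^2 <= m. *)
Definition shell N m : seq 'rV[int]_n :=
  [seq z <- [seq box_vec f | f : {ffun 'I_n -> 'I_(N.*2.+1)}]
     | dotp z z == m%:Z].

Definition rep m := size (shell m m).

Lemma box_vec_inj N : injective (@box_vec N).
Proof.
move=> f g /rowP fg; apply/ffunP => i; have := fg i; rewrite !mxE => h.
by apply/val_inj => /=; lia.
Qed.

Lemma shell_uniq N m : uniq (shell N m).
Proof. by rewrite filter_uniq // map_inj_uniq ?enum_uniq //; apply: box_vec_inj. Qed.

Lemma mem_shell N m z : (m <= N)%N -> (z \in shell N m) = (dotp z z == m%:Z).
Proof.
move=> mN; rewrite mem_filter; case: eqP => //= zz; apply/mapP.
have zi i : `|z 0 i| <= N%:Z.
  apply: le_trans (_ : z 0 i * z 0 i <= _); first by nia.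
  apply: le_trans (_ : m%:Z <= _); last by rewrite lez_nat.
  rewrite -zz /dotp (bigD1 i) //= lerDl; apply: sumr_ge0 => j _.
  by rewrite -expr2 sqr_ge0.
exists [ffun i => inord (absz (z 0 i + N%:Z))]; first by rewrite mem_enum.
by apply/rowP => i; rewrite mxE ffunE inordK; have := zi i; lia.
Qed.

Lemma repE N m : (m <= N)%N -> rep m = size (shell N m).
Proof.
move=> mN; apply/perm_size/uniq_perm; rewrite ?shell_uniq // => z.
by rewrite !mem_shell.
Qed.

Definition ratv (z : 'rV[int]_n) : 'rV[rat]_n := map_mx intr z.

Lemma ratv_inj : injective ratv.
Proof.
by move=> x y /rowP xy; apply/rowP => i; have := xy i; rewrite !mxE => /intr_inj.
Qed.

Lemma ratv_integral z : integral (ratv z).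
Proof. by apply/integralP => i; rewrite mxE intr_int. Qed.

Lemma integral_ratv x : integral x -> exists z, x = ratv z.
Proof.
move=> /integralP Lx; exists (\row_i Num.floor (x 0 i)).
apply/rowP => i; rewrite !mxE.
by rewrite floorK ?Lx.
Qed.

Lemma dotp_ratv y z : dotp (ratv y) (ratv z) = (dotp y z)%:~R.
Proof. exact: dotp_map. Qed.

Lemma isometric_shell (K : 'rV[rat]_n -> Prop) (f : 'rV[rat]_n -> 'rV[rat]_n)
    (s : seq 'rV[rat]_n) m :
    bijective f -> (forall x, dotp (f x) (f x) = dotp x x) ->
    (forall x, K x <-> integral (f x)) -> uniq s ->
    (forall x, x \in s <-> K x /\ dotp x x = m%:R) ->
  size s = rep m.
Proof.
move=> [g fK gK] fdot fKL s_uniq sP.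
rewrite /rep -(size_map (g \o ratv)); apply/perm_size/uniq_perm => //.
  rewrite map_inj_uniq ?shell_uniq //.
  exact: inj_comp (can_inj gK) ratv_inj.
move=> x; apply/idP/mapP => [/sP[/fKL/integral_ratv]|].
  case=> z xz xm; exists z; last by rewrite /= -xz fK.
  rewrite mem_shell //; apply/eqP/(@intr_inj rat).
  by rewrite -dotp_ratv -xz fdot.
case=> z; rewrite mem_shell // => /eqP zz -> /=; apply/sP; split.
  by apply/fKL; rewrite gK ratv_integral.
by rewrite -fdot gK dotp_ratv zz.
Qed.
End Shell.

Section Neighbor.
Variables (n p : nat).
Hypotheses (n_range : (0 < n <= 8)%N) (p_prime : prime p) (p_odd : odd p).

Let p_gt0 : (0 < p)%N := prime_gt0 p_prime.
Let p_neq0 : p%:R != 0 :> rat.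
Proof. by rewrite pnatr_eq0 -lt0n. Qed.

Definition red (z : 'rV[int]_n) : 'rV['F_p]_n := map_mx intr z.

Lemma intr_Fp_eq0 (a : int) : (a%:~R == 0 :> 'F_p) = (p %| a)%Z.
Proof. by rewrite (dvdz_pcharf (pchar_Fp p_prime)). Qed.

Lemma intr_Fp_surj (c : 'F_p) : exists a : int, c = a%:~R.
Proof. by exists (c : nat)%:Z; rewrite -[LHS]natr_Zp. Qed.

Lemma red_surj (v : 'rV['F_p]_n) : exists z, v = red z.
Proof.
exists (\row_i (v 0 i : nat)%:Z).
by apply/rowP => i; rewrite !mxE -[LHS]natr_Zp.
Qed.

Lemma dotp_red y z : dotp (red y) (red z) = (dotp y z)%:~R.
Proof. exact: dotp_map. Qed.

Lemma red_scale (a : int) z : red (a *: z) = a%:~R *: red z.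
Proof. by apply/rowP => i; rewrite !mxE intrM. Qed.

Lemma redD y z : red (y + z) = red y + red z.
Proof. by apply/rowP => i; rewrite !mxE intrD. Qed.

Lemma redB y z : red (y - z) = red y - red z.
Proof. by apply/rowP => i; rewrite !mxE intrB. Qed.

Lemma red_p z : red (p%:Z *: z) = 0.
Proof. by rewrite red_scale -pmulrn pchar_Fp_0 // scale0r. Qed.

Definition divp (z : 'rV[int]_n) : 'rV[int]_n :=
  map_mx (fun a => (a %/ p)%Z) z.

Lemma divpK z : red z = 0 -> p%:Z *: divp z = z.
Proof.
move=> /rowP z0; apply/rowP => i; rewrite !mxE mulrC divzK //.
by have := z0 i; rewrite !mxE => /eqP; rewrite intr_Fp_eq0.
Qed.

Lemma divp_int (a : int) : (p%:R^-1 * a%:~R : rat) \is a Num.int = (p %| a)%Z.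
Proof.
apply/idP/idP => [/intrP[b ab]|]; last by rewrite mulrC; apply: Qint_dvdz.
apply/dvdzP; exists b; apply/(@intr_inj rat).
by rewrite intrM -ab mulrAC mulVf ?mul1r.
Qed.

(** For z of norm divisible by p^2, this tests whether z/p lies in the p-neighbor attached to u,
    using residues modulo p only (see [in_neighborP]). *)
Definition in_neighbor (u : 'rV['F_p]_n) z :=
  if red z == 0 then dotp (red (divp z)) u == 0
  else [exists c, red z == c *: u].

Lemma two_Fp_neq0 : 2 != 0 :> 'F_p.
Proof.
apply/negP => /eqP p2; have := dvdn_pcharf (pchar_Fp p_prime) 2.
rewrite p2 eqxx dvdn_prime2 // => /eqP pp.
by move: p_odd; rewrite pp.
Qed.

Lemma rV_neq0_entry (u : 'rV['F_p]_n) : u != 0 -> exists i, u 0 i != 0.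
Proof.
move=> u0; apply/existsP; rewrite -[X in is_true X]negbK negb_exists.
apply: contra u0 => /forallP v0; apply/eqP/rowP => i.
by rewrite [RHS]mxE; apply/eqP; have := v0 i; rewrite negbK.
Qed.

Section Lift.
Variable v : 'rV[int]_n.
Hypotheses (v_neq0 : red v != 0) (v_iso : (p%:Z ^+ 2 %| dotp v v)%Z).

Let w : 'rV[rat]_n := p%:R^-1 *: ratv v.

(** Kneser's p-neighbor of Z^n at v, with w = v/p; since p^2 divides v.v, it contains w. *)
Definition neighbor (y : 'rV[rat]_n) :=
  (exists k : int, integral (y - k%:~R *: w)) /\ dotp w y \is a Num.int.

Let ww_int : dotp w w \is a Num.int.
Proof.
have [a va] := dvdzP v_iso.
rewrite /w dotpZl dotpZr dotp_ratv va.
have -> : p%:R^-1 * (p%:R^-1 * (a * p%:Z ^+ 2)%:~R) = a%:~R :> rat.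
  by rewrite intrM rmorphXn /= -pmulrn; field.
exact: intr_int.
Qed.

Let neighbor_w : neighbor w.
Proof. by split=> //; exists 1; rewrite scale1r subrr integral0. Qed.

Let neighbor_integral x : integral x -> dotp w x \is a Num.int -> neighbor x.
Proof. by move=> Lx wx; split=> //; exists 0; rewrite scale0r subr0. Qed.

(** For the converse, let t invert v_i modulo p. Testing y against p t e_i shows that c = p t y_i is
    an integer, and testing it against e_j - v_j t e_i shows that y - c w is integral. *)
Lemma neighbor_selfdual : selfdual neighbor.
Proof.
move=> y; split=> [[[k Lk] wy] x [[l Ll] wx]|Ky].
  have -> : dotp x y = dotp (x - l%:~R *: w) (y - k%:~R *: w)
      + l%:~R * dotp w y + k%:~R * dotp w x - k%:~R * l%:~R * dotp w w.
    by move: w => w'; rewrite !dotpE (dotpC x w'); ring.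
  by rewrite rpredB ?rpredD ?dotp_int // ?rpredM ?intr_int.
split; last exact: Ky.
have [i vi] := rV_neq0_entry v_neq0.
have [t tE] := intr_Fp_surj (red v 0 i)^-1.
have [b bE] : exists b : int, 1 - t * v 0 i = b * p%:Z.
  apply/dvdzP; rewrite -intr_Fp_eq0 intrB intrM -tE.
  by move: vi; rewrite mxE => vi; rewrite mulVf // subrr.
have w_delta j : dotp w (delta_mx 0 j) = p%:R^-1 * (v 0 j)%:~R.
  by rewrite dotp_delta !mxE.
have delta_y j : dotp (delta_mx 0 j) y = y 0 j by rewrite dotpC dotp_delta.
have tyi : p%:R * t%:~R * y 0 i \is a Num.int.
  rewrite -delta_y -dotpZl; apply: Ky; apply: neighbor_integral.
    by rewrite integralZ ?rpredM ?intr_int ?natr_int // delta_integral.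
  rewrite dotpZr w_delta mulrACA mulfV // mul1r.
  by rewrite rpredM ?intr_int.
have [c cE] := intrP tyi.
exists c; apply/integralP => j.
have -> : (y - c%:~R *: w) 0 j
    = dotp (delta_mx 0 j - (v 0 j * t)%:~R *: delta_mx 0 i) y.
  rewrite dotpBl dotpZl !delta_y !mxE -cE intrM; field.
  by rewrite p_neq0.
apply: Ky; apply: neighbor_integral.
  by rewrite integralB ?integralZ ?intr_int ?delta_integral.
rewrite dotpBr dotpZr !w_delta.
have -> : p%:R^-1 * (v 0 j)%:~R - (v 0 j * t)%:~R * (p%:R^-1 * (v 0 i)%:~R)
   = (v 0 j * b)%:~R :> rat.
  have := congr1 (fun a : int => a%:~R : rat) bE.
  rewrite /= !(intrM, intrB) -pmulrn => E.
  transitivity (p%:R^-1 * (v 0 j)%:~R * (b%:~R * p%:R) : rat).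
    by rewrite -E; ring.
  by field.
exact: intr_int.
Qed.

Lemma neighbor_odd : odd_lattice neighbor.
Proof.
have [n0 _] := andP n_range.
(* With p = 2h + 1, the vector p e_0 has norm p^2 = 2 (2h(h+1)) + 1. *)
exists (p%:R *: delta_mx 0 (Ordinal n0)), (2 * p./2%:Z * (p./2%:Z + 1)).
split.
  apply: neighbor_integral.
    by rewrite integralZ ?natr_int // delta_integral.
  rewrite dotpZr dotp_delta !mxE mulrA divff // mul1r.
  exact: intr_int.
have pE : p%:Z = 2 * p./2%:Z + 1 by have := odd_double_half p; lia.
rewrite dotpZl dotpZr dotp_delta mxE !eqxx mulr1 -(natrM _ p p).
rewrite -[LHS]/((p * p)%N%:Z%:~R); congr (_%:~R).
by rewrite PoszM pE; ring.
Qed.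

Lemma neighbor_cyclic : cyclic_over neighbor w p.
Proof.
split=> //; last by move=> x [].
by rewrite scalerA divff // scale1r ratv_integral.
Qed.

(** The delicate case is z = k v + p l with k prime to p: as p^2 divides z.z and v.v, p divides 2 k
    v.l, hence v.l since p is odd, and so w.(z/p) is an integer. *)
Lemma in_neighborP z m : dotp z z = p%:Z ^+ 2 * m ->
  neighbor (p%:R^-1 *: ratv z) <-> in_neighbor (red v) z.
Proof.
move=> zz; rewrite /in_neighbor; case: (eqVneq (red z) 0) => [z0|zn0].
  have -> : p%:R^-1 *: ratv z = ratv (divp z).
    rewrite -{1}(divpK z0); apply/rowP => i; rewrite !mxE intrM -pmulrn.
    by rewrite mulrA mulVf ?mul1r.
  have wE : (dotp w (ratv (divp z)) \is a Num.int)
      = (dotp (red (divp z)) (red v) == 0).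
    by rewrite dotpZl dotp_ratv divp_int dotp_red intr_Fp_eq0 dotpC.
  split=> [[_]|]; rewrite -?wE //.
  by apply: neighbor_integral; apply: ratv_integral.
split=> [[[k /integral_ratv[l lE]] _]|/existsP[c /eqP cE]].
  apply/existsP; exists k%:~R; apply/eqP.
  have -> : z = k *: v + p%:Z *: l.
    apply: ratv_inj; apply/rowP => i.
    have /rowP/(_ i) := lE; rewrite !mxE !(intrM, intrD) -pmulrn => <-.
    by field.
  by rewrite redD red_p addr0 red_scale.
have [k kE] := intr_Fp_surj c.
have [l zE] : exists l, z = k *: v + p%:Z *: l.
  have zk : red (z - k *: v) = 0.
    by rewrite redB red_scale cE kE subrr.
  by exists (divp (z - k *: v)); rewrite (divpK zk) [RHS]addrC subrK.
have c0 : c != 0 by apply: contraNneq zn0 => c0; rewrite cE c0 scale0r.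
have [a va] := dvdzP v_iso.
have vl : (p %| dotp v l)%Z.
  have : (p %| 2 * k * dotp v l)%Z.
    apply/dvdzP; exists (m - k ^+ 2 * a - dotp l l).
    have pz : p%:Z != 0 by rewrite eqz_nat -lt0n.
    apply: (mulfI pz); move: zz; rewrite zE !dotpE va (dotpC l v) => zz.
    transitivity (p%:Z ^+ 2 * m - k * (k * (a * p%:Z ^+ 2))
      - p%:Z * (p%:Z * dotp l l)); last by ring.
    by rewrite -zz; ring.
  rewrite -!intr_Fp_eq0 !intrM -kE !mulf_eq0 (negPf c0) orbF.
  by rewrite (negPf two_Fp_neq0).
split.
  exists k; have -> : p%:R^-1 *: ratv z - k%:~R *: w = ratv l.
    by rewrite zE; apply/rowP => i; rewrite !mxE !(intrM, intrD) -pmulrn; field.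
  exact: ratv_integral.
rewrite dotpZl dotpZr dotp_ratv zE !dotpE va.
have [b bE] := dvdzP vl.
rewrite bE; have -> : p%:R^-1 * (p%:R^-1 *
    (k * (a * p%:Z ^+ 2) + p%:Z * (b * p%:Z))%:~R) = (k * a + b)%:~R :> rat.
  by rewrite !(intrM, intrD, rmorphXn) /= -pmulrn; field.
exact: intr_int.
Qed.

(** Division by p sends the counted vectors bijectively to the vectors of norm m in the neighbor,
    which is isometric to Z^n by [cyclic_neighbor_isometric]. *)
Lemma count_in_neighbor m :
  count (in_neighbor (red v)) (shell n (p ^ 2 * m) (p ^ 2 * m)) = rep n m.
Proof.
have [f [fbij fdot fK]] :=
  cyclic_neighbor_isometric n_range neighbor_selfdual neighbor_odd neighbor_cyclic.
rewrite -size_filter -(size_map (fun z => p%:R^-1 *: ratv z)).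
have pV_inj : injective (fun z : 'rV[int]_n => p%:R^-1 *: ratv z).
  apply: inj_comp (@ratv_inj n).
  by apply: can_inj (_ : cancel _ ( *:%R p%:R)) => x; rewrite scalerA divff ?scale1r.
have dot_pV z : dotp (p%:R^-1 *: ratv z) (p%:R^-1 *: ratv z) = m%:R <->
    z \in shell n (p ^ 2 * m) (p ^ 2 * m).
  rewrite mem_shell // dotpZl dotpZr dotp_ratv; split=> [zz|/eqP ->].
    apply/eqP/(@intr_inj rat); rewrite -pmulrn natrM -zz natrX; field.
    by rewrite p_neq0.
  by rewrite -pmulrn natrM natrX; field; rewrite p_neq0.
have shell_norm z :
    z \in shell n (p ^ 2 * m) (p ^ 2 * m) -> dotp z z = p%:Z ^+ 2 * m.
  by rewrite mem_shell // => /eqP ->; rewrite Posz_sqrM.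
apply: (isometric_shell fbij fdot fK).
  by rewrite (map_inj_uniq pV_inj); apply: filter_uniq; apply: shell_uniq.
move=> x; split=> [/mapP[z]|[Kx xx]].
  rewrite mem_filter => /andP[zP zs] ->; split; last exact/dot_pV.
  exact/(in_neighborP (shell_norm _ zs)).
have Lpx : integral (p%:R *: x).
  have [[k Lk] _] := Kx.
  have -> : p%:R *: x = p%:R *: (x - k%:~R *: w) + k%:~R *: ratv v.
    by apply/rowP => i; rewrite !mxE; field; rewrite p_neq0.
  by rewrite integralD // integralZ ?natr_int ?intr_int // ratv_integral.
have [z zE] := integral_ratv Lpx.
have xE : x = p%:R^-1 *: ratv z by rewrite -zE scalerA mulVf ?scale1r.
apply/mapP; exists z => //; rewrite mem_filter.
have zs : z \in shell n (p ^ 2 * m) (p ^ 2 * m) by apply/dot_pV; rewrite -xE.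
by rewrite zs andbT; apply/(in_neighborP (shell_norm _ zs)); rewrite -xE.
Qed.
End Lift.

(** Hensel lifting: if v.v = a p, adding p s e_i changes v.v/p by 2 s v_i modulo p, and s is chosen
    to cancel a. *)
Lemma isotropic_lift (u : 'rV['F_p]_n) : u != 0 -> dotp u u = 0 ->
  exists2 v, red v = u & (p%:Z ^+ 2 %| dotp v v)%Z.
Proof.
move=> u0 uu; have [v uE] := red_surj u.
have : dotp (red v) (red v) == 0 by rewrite -uE uu.
rewrite dotp_red intr_Fp_eq0 => /dvdzP[a va].
have [i ui] := rV_neq0_entry u0.
have [s sE] := intr_Fp_surj (- a%:~R / (2 * u 0 i)).
exists (v + p%:Z *: (s *: delta_mx 0 i)); first by rewrite redD red_p addr0.
have /dvdzP[b bE] : (p %| (a + 2 * s * v 0 i)%R)%Z.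
  rewrite -intr_Fp_eq0 intrD !intrM -sE.
  have <- : u 0 i = (v 0 i)%:~R by rewrite uE mxE.
  by apply/eqP; field; rewrite ui two_Fp_neq0.
apply/dvdzP; exists (b + s ^+ 2); rewrite !dotpE va (dotpC _ v) !dotp_delta.
rewrite mxE !eqxx mulr1.
transitivity (p%:Z * (a + 2 * s * v 0 i) + p%:Z ^+ 2 * s ^+ 2); first by ring.
by rewrite bE; ring.
Qed.

Lemma shell_red0 m :
  perm_eq [seq z <- shell n (p ^ 2 * m) (p ^ 2 * m) | red z == 0]
          [seq p%:Z *: y | y <- shell n m m].
Proof.
have pz : p%:Z != 0 by rewrite eqz_nat -lt0n.
have p_inj : injective (fun y : 'rV[int]_n => p%:Z *: y).
  by move=> x y /rowP xy; apply/rowP => i; have := xy i; rewrite !mxE => /(mulfI pz).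
have pp y : (dotp (p%:Z *: y) (p%:Z *: y) == (p ^ 2 * m)%:Z) = (dotp y y == m%:Z).
  rewrite dotpZl dotpZr Posz_sqrM mulrA.
  by apply/eqP/eqP => [/(mulfI (expf_neq0 2 pz))|->].
apply: uniq_perm.
- by rewrite filter_uniq // shell_uniq.
- by rewrite (map_inj_uniq p_inj) shell_uniq.
move=> z; rewrite mem_filter mem_shell //; apply/andP/mapP.
  case=> /eqP z0; rewrite -(divpK z0) pp => zz; exists (divp z) => //.
  by rewrite mem_shell.
by case=> y; rewrite mem_shell // => yy ->; rewrite pp red_p.
Qed.

Lemma count_red0 m :
  count (fun z => red z == 0) (shell n (p ^ 2 * m) (p ^ 2 * m)) = rep n m.
Proof. by rewrite -size_filter (perm_size (shell_red0 m)) size_map. Qed.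

Lemma count_red0_eq0 m : ~~ (p ^ 2 %| m)%N ->
  count (fun z => red z == 0) (shell n m m) = 0%N.
Proof.
move=> pm; apply/eqP; rewrite -leqn0 leqNgt -has_count.
apply: contra pm => /hasP[z]; rewrite mem_shell // => /eqP zz /eqP z0.
have : (p%:Z ^+ 2 %| m%:Z)%Z.
  apply/dvdzP; exists (dotp (divp z) (divp z)).
  by rewrite -zz -{1 2}(divpK z0) dotpZl dotpZr; ring.
by rewrite dvdzE abszX.
Qed.

Section Family.
Variable V : {set 'rV['F_p]_n}.
Hypotheses (V_neq0 : 0 \notin V) (V_iso : forall u, u \in V -> dotp u u = 0)
  (V_scale : forall c u, c != 0 -> u \in V -> c *: u \in V).

(** The condition puts u on the line of [red z], whose p - 1 nonzero vectors are all in V or all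
    outside it. *)
Lemma count_in_neighbor_family z : red z != 0 ->
  #|[set u in V | in_neighbor u z]| = (p.-1 * (red z \in V))%N.
Proof.
move=> z0; have [zV|zV] := boolP (red z \in V); last first.
  rewrite muln0; apply/eqP; rewrite cards_eq0; apply/eqP/setP => u; rewrite !inE.
  apply/negP => /andP[uV]; rewrite /in_neighbor (negPf z0) => /existsP[c /eqP zE].
  move: zV; rewrite zE V_scale //.
  by apply: contraNneq z0 => c0; rewrite zE c0 scale0r.
rewrite muln1; have -> : p.-1 = #|[set~ (0 : 'F_p)]|.
  by rewrite cardsC1 card_Fp.
have inj : injective (fun c => c *: red z).
  have [i zi] := rV_neq0_entry z0.
  by move=> c c' /rowP/(_ i); rewrite mxE [RHS]mxE => /(mulIf zi).
rewrite -(card_imset _ inj); apply: eq_card => u; rewrite !inE.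
rewrite /in_neighbor (negPf z0); apply/andP/imsetP.
  case=> uV /existsP[c /eqP zE].
  have c0 : c != 0 by apply: contraNneq z0 => c0; rewrite zE c0 scale0r.
  by exists c^-1; rewrite ?inE ?invr_eq0 // zE scalerA mulVf ?scale1r.
case=> c; rewrite !inE => c0 ->; split; first exact: V_scale.
by apply/existsP; exists c^-1; rewrite scalerA mulVf ?scale1r.
Qed.

(* Double counting of the pairs (u, x) with u in V and x a vector of norm m in
   the p-neighbor of Z^n attached to u. *)
Theorem shell_relation m :
  (#|V| * rep n m =
   p.-1 * count (fun z => red z \in V) (shell n (p ^ 2 * m) (p ^ 2 * m)) +
   \sum_(y <- shell n m m) #|[set u in V | dotp (red y) u == 0%R]|)%N.
Proof.
set S := shell n (p ^ 2 * m) (p ^ 2 * m).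
have -> : (#|V| * rep n m = \sum_(z <- S) #|[set u in V | in_neighbor u z]|)%N.
  under [RHS]eq_bigr => z _ do rewrite -sum1_card big_mkcond.
  rewrite exchange_big /= -sum_nat_const big_mkcond /=; apply: eq_bigr => u _.
  case: ifP => uV; last by rewrite big1 // => z _; rewrite !inE uV.
  have u0 : u != 0 by apply: contraNneq V_neq0 => <-.
  have [v vu vv] := isotropic_lift u0 (V_iso uV).
  rewrite -(@count_in_neighbor v) ?vu // -sum1_count big_mkcond.
  by apply: eq_bigr => z _; rewrite !inE uV.
(* Vectors nonzero modulo p give the first term; those of the form p y, with y of norm m, give the
   second. *)
rewrite (bigID (fun z => red z != 0)) /=; congr (_ + _)%N.
  under eq_bigr => z z0 do rewrite (count_in_neighbor_family z0).
  rewrite -big_distrr /= -sum1_count; congr (_ * _)%N.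
  rewrite big_mkcond [RHS]big_mkcond; apply: eq_bigr => z _ /=.
  case: eqVneq => [->|_] /=; first by rewrite (negPf V_neq0).
  by case: ifP.
under eq_bigl => z do rewrite negbK.
rewrite -big_filter (perm_big _ (shell_red0 m)) big_map.
apply: eq_bigr => y _; apply: eq_card => u; rewrite !inE /in_neighbor red_p eqxx.
have -> // : divp (p%:Z *: y) = y.
by apply/rowP => i; rewrite !mxE mulrC mulzK // eqz_nat -lt0n.
Qed.
End Family.
End Neighbor.

(** * Counting vectors in quadratic spaces over F_p *)

Section FiniteGeometry.
Variables (n p : nat).
Hypothesis p_prime : prime p.
Implicit Types u v : 'rV['F_p]_n.

Lemma card_rVFp : #|{: 'rV['F_p]_n}| = (p ^ n)%N.
Proof. by rewrite card_mx card_Fp // mul1n. Qed.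

(** Fixing e with u.e = 1, every vector is uniquely v + s e with v orthogonal to u. *)
Lemma card_hyperplane u : u != 0 ->
  (#|[set v | dotp u v == 0%R]| * p = p ^ n)%N.
Proof.
move=> /rV_neq0_entry[i ui].
have [e ue] : exists e, dotp u e = 1.
  by exists ((u 0 i)^-1 *: delta_mx 0 i); rewrite dotpZr dotp_delta mulVf.
rewrite -card_rVFp -[X in (_ * X)%N](card_Fp p_prime) -cardsT -cardsX.
pose g (x : 'rV['F_p]_n * 'F_p) := x.1 + x.2 *: e.
rewrite -(@card_in_imset _ _ g) => [|[v s] [v' s']]; last first.
  rewrite !inE !andbT /= => /eqP uv /eqP uv' vv.
  have ss : s = s'.
    by have := congr1 (dotp u) vv; rewrite /g /= !dotpE uv uv' ue !add0r !mulr1.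
  by move: vv; rewrite /g /= ss => /addIr ->.
rewrite -cardsT; apply: eq_card => v; rewrite !inE; apply/imsetP.
exists (v - dotp u v *: e, dotp u v); last by rewrite /g /= subrK.
by rewrite !inE /= !dotpE ue mulr1 subrr eqxx.
Qed.

(** Along v + s u the norm is v.v + 2 s u.v, which vanishes for exactly one s when u.v is nonzero.
    So the counted set times F_p is in bijection with the p^n - p^(n-1) vectors not orthogonal to
    u. *)
Lemma card_isotropic_pairing u : odd p -> (1 < n)%N -> u != 0 -> dotp u u = 0 ->
  #|[set v | (dotp v v == 0) && (dotp u v != 0)]| = (p.-1 * p ^ n.-2)%N.
Proof.
move=> p_odd n_gt1 u0 uu; have p_gt0 := prime_gt0 p_prime.
have n2 : n = n.-2.+2 by case: n n_gt1 => [|[]].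
apply/eqP; rewrite -(eqn_pmul2r p_gt0); apply/eqP.
transitivity #|~: [set v | dotp u v == 0]|; last first.
  have nE : (p ^ n = p * (p * p ^ n.-2))%N by rewrite {1}n2 !expnS.
  have := cardsC [set v | dotp u v == 0]; have := card_hyperplane u0.
  rewrite card_rVFp nE mulnC => /eqP; rewrite eqn_pmul2l // => /eqP -> cC.
  apply: (@addnI (p * p ^ n.-2)%N); rewrite cC [(_ * p)%N]mulnC -mulnDr.
  by rewrite -mulSn prednK.
rewrite -[X in (_ * X)%N](card_Fp p_prime) -cardsT -cardsX.
pose g (x : 'rV['F_p]_n * 'F_p) := x.1 + x.2 *: u.
have two0 := two_Fp_neq0 p_prime p_odd.
rewrite -(@card_in_imset _ _ g) => [|[v s] [v' s']]; last first.
  rewrite !inE !andbT /= => /andP[/eqP vv uv] /andP[/eqP vv' uv'] gg.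
  have uvE : dotp u v = dotp u v'.
    by have := congr1 (dotp u) gg; rewrite /g /= !dotpE uu !mulr0 !addr0.
  have ss : s = s'.
    have := congr1 (fun x => dotp x x) gg.
    rewrite /g /= !dotpE !(dotpC _ u) uu vv vv' uvE !mulr0 !addr0 !add0r -!mulr2n.
    move=> /eqP; rewrite -subr_eq0 -mulrnBl -mulr_natl mulf_eq0 (negPf two0) /=.
    by rewrite subr_eq0 => /eqP /(mulIf uv').
  by move: gg; rewrite /g /= ss => /addIr ->.
apply: eq_card => v; rewrite !inE; apply/imsetP/idP => [[[w s]]|uv].
  rewrite !inE andbT /= => /andP[_ uw] ->.
  by rewrite /g /= !dotpE uu mulr0 addr0.
have uv2 : 2 * dotp u v != 0 by rewrite mulf_neq0.
have [s sE] : exists s, s * (2 * dotp u v) = dotp v v.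
  by exists (dotp v v / (2 * dotp u v)); rewrite divfK.
exists (v - s *: u, s); last by rewrite /g /= subrK.
rewrite !inE andbT /= !dotpE uu (dotpC v u) !(mulr0, oppr0, addr0) uv andbT.
by rewrite -sE; apply/eqP; ring.
Qed.

(* The map v |-> v + f v generates an action of Z/p on A without fixed points. *)
Lemma card_translation_free (A : {set 'rV['F_p]_n}) f :
    (forall v, f v != 0) ->
    (forall v, v \in A -> v + f v \in A) ->
    (forall v, v \in A -> f (v + f v) = f v) ->
  (p %| #|A|)%N.
Proof.
move=> f0 fA ff; pose t v := if v \in A then v + f v else v.
have t_inj : injective t.
  move=> v v'; rewrite /t; case: ifP => vA; case: ifP => v'A vv'; last by [].
  - have fE : f v = f v' by rewrite -(ff v) // vv' ff.
    by move: vv'; rewrite fE => /addIr.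
  - by move: (fA _ vA); rewrite vv' v'A.
  - by move: (fA _ v'A); rewrite -vv' vA.
pose s := perm t_inj.
have sX k v : v \in A -> [/\ (s ^+ k)%g v \in A, (s ^+ k)%g v = v + f v *+ k &
    f ((s ^+ k)%g v) = f v].
  move=> vA; elim: k => [|k [IH1 IH2 IH3]].
    by rewrite expg0 perm1 mulr0n addr0.
  rewrite expgSr permM permE /t IH1; split.
  - exact: fA.
  - by rewrite IH3 IH2 mulrSr addrA.
  - by rewrite ff.
have sp : (s ^+ p = 1)%g.
  apply/permP => v; rewrite perm1; have [vA|vA] := boolP (v \in A).
    have [_ -> _] := sX p v vA.
    by rewrite -scaler_nat pchar_Fp_0 // scale0r addr0.
  suff sk k : (s ^+ k)%g v = v by [].
  elim: k => [|k IH]; first by rewrite expg0 perm1.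
  by rewrite expgSr permM IH permE /t (negPf vA).
have pG : (p.-group <[s]>)%g.
  rewrite /pgroup -orderE; apply: pnat_dvd (pnat_id p_prime).
  by rewrite order_dvdn sp.
have sA : [acts <[s]>, on A | 'P]%g.
  rewrite cycle_subG; apply/astabsP => v /=; rewrite apermE permE /t.
  by case: ifP => // vA; rewrite fA.
have := pgroup_fix_mod pG sA.
suff -> : ('Fix_(A | 'P)(<[s]>))%g = set0 by rewrite cards0 mod0n => /eqP.
apply/setP => v; rewrite in_set0 inE; apply/negP => /andP[vA /afixP].
move=> /(_ s (cycle_id s)); rewrite /= apermE permE /t vA.
by move/eqP; rewrite -subr_eq0 addrAC subrr add0r (negPf (f0 v)).
Qed.
End FiniteGeometry.

(** * Hecke-type relations between representation numbers *)

Section Hecke.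
Variables (n p : nat).
Hypotheses (n_range : (0 < n <= 8)%N) (p_prime : prime p) (p_odd : odd p).

Definition pairing (u : 'rV['F_p]_n) :=
  #|[set v : 'rV['F_p]_n | (dotp v v == 0) && (dotp u v != 0)]|.

(** Take for V all nonzero isotropic vectors in [shell_relation]. Vectors of norm p^2 m are
    isotropic modulo p, so all of them except the [rep n m] multiples of p reduce into V; passing to
    complements in V on the right then cancels the term #|V| * rep n m. *)
Lemma rep_pairing m :
  (\sum_(y <- shell n m m) pairing (red p y) + p.-1 * rep n m
   = p.-1 * rep n (p ^ 2 * m))%N.
Proof.
pose V := [set v : 'rV['F_p]_n | (v != 0) && (dotp v v == 0)].
have V0 : 0 \notin V by rewrite !inE eqxx.
have V_iso u : u \in V -> dotp u u = 0 by rewrite inE => /andP[_ /eqP].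
have V_scale c u : c != 0 -> u \in V -> c *: u \in V.
  move=> c0; rewrite !inE scaler_eq0 negb_or c0 /= => /andP[-> /eqP uu].
  by rewrite dotpZl dotpZr uu !mulr0 eqxx.
have := shell_relation n_range p_prime p_odd V0 V_iso V_scale m.
set S := shell n (p ^ 2 * m) (p ^ 2 * m).
have -> : count (fun z => red p z \in V) S = (rep n (p ^ 2 * m) - rep n m)%N.
  rewrite -(count_red0 n p_prime m) -/S -[rep n (p ^ 2 * m)]/(size S).
  rewrite -(count_predC (fun z => red p z == 0) S) addKn.
  apply: eq_in_count => z; rewrite mem_shell // => /eqP zz.
  rewrite !inE /= dotp_red zz Posz_sqrM intrM rmorphXn /= -pmulrn.
  by rewrite pchar_Fp_0 // expr0n mul0r eqxx andbT.
have cE y : (#|[set u in V | dotp (red p y) u == 0%R]| + pairing (red p y) = #|V|)%N.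
  rewrite -(cardsID [set u | dotp (red p y) u == 0%R] V); congr (_ + _)%N.
    by apply: eq_card => u; rewrite !inE.
  apply: eq_card => u; rewrite !inE; case: (eqVneq u 0) => [->|_] /=.
    by rewrite !dotp0r eqxx ?andbF.
  by rewrite andbC.
have le_rep : (rep n m <= rep n (p ^ 2 * m))%N.
  rewrite -(count_red0 n p_prime m); exact: count_size.
have sumE : (\sum_(y <- shell n m m) #|[set u in V | dotp (red p y) u == 0%R]|
    + \sum_(y <- shell n m m) pairing (red p y) = #|V| * rep n m)%N.
  rewrite -big_split /=; under eq_bigr => y _ do rewrite cE.
  by rewrite big_const_seq count_predT iter_addn_0.
rewrite -sumE addnC mulnBr => /addIn ->.
by rewrite subnK // leq_mul2l le_rep orbT.
Qed.

(** As p divides m, every [red p y] is isotropic, so its pairing number is 0 if it vanishes and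
    (p-1) p^(n-2) otherwise. *)
Lemma rep_hecke m : (1 < n)%N -> (p %| m)%N ->
  rep n (p ^ 2 * m) =
    (rep n m + p ^ n.-2 * count (fun y => red p y != 0%R) (shell n m m))%N.
Proof.
move=> n_gt1 pm; have p1 : (0 < p.-1)%N by have := prime_gt1 p_prime; lia.
apply/eqP; rewrite -(eqn_pmul2l p1) -rep_pairing mulnDr addnC eqn_add2l mulnA.
rewrite -sum1_count big_distrr /= [X in _ == X]big_mkcond /= big_seq [X in _ == X]big_seq.
apply/eqP; apply: eq_bigr => y; rewrite mem_shell // => /eqP yy.
have yy0 : dotp (red p y) (red p y) = 0.
  by apply/eqP; rewrite dotp_red yy intr_Fp_eq0.
case: eqVneq => [y0|y0] /=.
  rewrite y0; apply/eqP; rewrite cards_eq0; apply/eqP/setP => u.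
  by rewrite !inE dotp0l eqxx andbF.
by rewrite muln1; apply: card_isotropic_pairing.
Qed.

(** This is [rep_hecke] at p^2 m, where the vectors divisible by p are counted by [rep n m]. *)
Lemma rep_hecke2 m : (1 < n)%N -> (p %| m)%N ->
  (rep n (p ^ 2 * (p ^ 2 * m)) + p ^ n.-2 * rep n m
   = (1 + p ^ n.-2) * rep n (p ^ 2 * m))%N.
Proof.
move=> n_gt1 pm; rewrite rep_hecke ?dvdn_mull // -addnA -mulnDr.
rewrite -(count_red0 n p_prime m) [(count _ _ + _)%N]addnC.
by rewrite (count_predC (fun y => red p y == 0)) mulnDl mul1n.
Qed.

Lemma rep_hecke1 m : (1 < n)%N -> (p %| m)%N -> ~~ (p ^ 2 %| m)%N ->
  rep n (p ^ 2 * m) = ((1 + p ^ n.-2) * rep n m)%N.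
Proof.
move=> n_gt1 pm p2m; rewrite rep_hecke //.
have := count_predC (fun y => red p y == 0) (shell n m m).
rewrite (count_red0_eq0 n p_prime p2m) add0n => ->.
by rewrite mulnDl mul1n.
Qed.
End Hecke.

(** * Congruences modulo 11 in dimensions 7 and 8 *)

Lemma dotp_mulmx (R : comPzRingType) n (x y : 'rV[R]_n) :
  dotp x y = (x *m y^T) 0 0.
Proof. by rewrite mxE; apply: eq_bigr => i _; rewrite mxE. Qed.

Lemma dotp_mulmxr (R : comPzRingType) k n (c : 'rV[R]_k) (Y : 'M_(k, n)) x :
  dotp (c *m Y) x = (c *m (Y *m x^T)) 0 0.
Proof. by rewrite dotp_mulmx mulmxA. Qed.

Lemma mulmx_row2_eq0 (R : pzRingType) k l m1 m2 (c : 'M[R]_(k, l))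
    (A : 'M_(l, m1)) (B : 'M_(l, m2)) :
  c *m row_mx A B = 0 -> c *m A = 0 /\ c *m B = 0.
Proof. by rewrite mul_mx_row -row_mx0 => /eq_row_mx. Qed.

(* Each v is translated by an element of the row space of Y orthogonal to both
   u and v; it depends only on Y *m v^T, which the translation preserves. *)
Lemma dvdn_pairing n p k (u : 'rV['F_p]_n) (Y : 'M['F_p]_(k, n)) :
  prime p -> (2 < k)%N -> row_free Y -> Y *m Y^T = 0 -> (p %| pairing u)%N.
Proof.
move=> p_prime k2 Yfree YY.
pose M (v : 'rV['F_p]_n) := row_mx (Y *m v^T) (Y *m u^T).
(* [M v] has two columns and k > 2 rows, so its left kernel is nonzero. *)
pose c v := nz_row (kermx (M v)).
have cM v : c v *m M v = 0 by apply/sub_kermxP; apply: nz_row_sub.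
have c0 v : c v != 0.
  rewrite nz_row_eq0 -mxrank_eq0 mxrank_ker subn_eq0 -ltnNge.
  by apply: leq_ltn_trans (rank_leq_col _) _.
have cv v : dotp (c v *m Y) v = 0 /\ dotp (c v *m Y) u = 0.
  have [e1 e2] := mulmx_row2_eq0 (cM v).
  by rewrite !dotp_mulmxr e1 e2 mxE.
have cc v : dotp (c v *m Y) (c v *m Y) = 0.
  by rewrite dotp_mulmxr trmx_mul (mulmxA Y) YY mul0mx mulmx0 mxE.
apply: (@card_translation_free _ _ p_prime _ (fun v => c v *m Y)) => v.
- apply: contra (c0 v) => /eqP; rewrite -(mul0mx _ Y) => /(row_free_inj Yfree).
  by move->.
- rewrite !inE => /andP[/eqP vv uv]; have [e1 e2] := cv v.
  by rewrite !dotpE !(dotpC _ (c v *m Y)) vv cc e1 e2 !addr0 eqxx.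
suff ME : M (v + c v *m Y) = M v by rewrite {1}/c ME.
rewrite {1}/M; congr row_mx.
by rewrite linearD /= mulmxDr trmx_mul (mulmxA Y) YY mul0mx addr0.
Qed.

(** The rows are pairwise orthogonal integer vectors of norm 9 + 1 + 1 = 11, so modulo 11 they span
    a totally isotropic space of dimension 3, as [dvdn_pairing] requires. *)
Definition isotropic_basis11 : 'M['F_11]_(3, 7) :=
  \matrix_(i < 3, j < 7) (nth 0 (nth [::]
    [:: [:: 3; 1; 1; 0; 0; 0; 0]; [:: 0; 0; 0; 3; 1; 1; 0];
        [:: 0; 1; -1; 0; 0; 0; 3]] i) j).

Lemma isotropic_basis11_isotropic :
  isotropic_basis11 *m isotropic_basis11^T = 0.
Proof.
apply/matrixP => i j; rewrite !mxE.
do 7 rewrite big_ord_recl; rewrite big_ord0 !mxE.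
by case: i => [[|[|[|]]] ?] //; case: j => [[|[|[|]]] ?] //; apply/eqP.
Qed.

Lemma isotropic_basis11_free : row_free isotropic_basis11.
Proof.
(* Columns 0, 3 and 6 form three times the identity, which gives a right inverse. *)
apply/row_freeP; exists (\matrix_(i < 7, j < 3) (3^-1 *+ (i == j * 3 :> nat)%N)).
apply/matrixP => i j; rewrite !mxE.
do 7 rewrite big_ord_recl; rewrite big_ord0 !mxE.
by case: i => [[|[|[|]]] ?] //; case: j => [[|[|[|]]] ?] //; apply/eqP.
Qed.

(** By [rep_pairing] at p = 11, ten times the difference of the two sides is a sum of pairing
    numbers, each divisible by 11. *)
Lemma rep7_mod11 m : rep 7 (11 ^ 2 * m) = rep 7 m %[mod 11].
Proof.
have := rep_pairing (isT : (0 < 7 <= 8)%N) (isT : prime 11) isT m.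
set s := (\sum_(y <- _) _)%N; have : (11 %| s)%N.
  apply: dvdn_sum => y _.
  exact: dvdn_pairing isotropic_basis11_free isotropic_basis11_isotropic.
by rewrite /=; lia.
Qed.

(* Two copies of left multiplication by the quaternion 3 + i + j of norm 11. *)
Definition similarity11 : 'M[int]_8 :=
  \matrix_(i < 8, j < 8) (nth 0 (nth [::]
    [:: [:: 3; 1; 1; 0; 0; 0; 0; 0]; [:: -1; 3; 0; -1; 0; 0; 0; 0];
        [:: -1; 0; 3; 1; 0; 0; 0; 0]; [:: 0; 1; -1; 3; 0; 0; 0; 0];
        [:: 0; 0; 0; 0; 3; 1; 1; 0]; [:: 0; 0; 0; 0; -1; 3; 0; -1];
        [:: 0; 0; 0; 0; -1; 0; 3; 1]; [:: 0; 0; 0; 0; 0; 1; -1; 3]] i) j).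
Local Notation G := similarity11.

Lemma similarity11_mulT : G *m G^T = 11%:M.
Proof.
apply/matrixP => i j; rewrite !mxE.
do 8 rewrite big_ord_recl; rewrite big_ord0 !mxE.
by case: i => [[|[|[|[|[|[|[|[|]]]]]]]] ?] //;
   case: j => [[|[|[|[|[|[|[|[|]]]]]]]] ?] //; apply/eqP.
Qed.

Lemma similarity11_Tmul : G^T *m G = 11%:M.
Proof.
apply/matrixP => i j; rewrite !mxE.
do 8 rewrite big_ord_recl; rewrite big_ord0 !mxE.
by case: i => [[|[|[|[|[|[|[|[|]]]]]]]] ?] //;
   case: j => [[|[|[|[|[|[|[|[|]]]]]]]] ?] //; apply/eqP.
Qed.

Lemma dotp_similarity11 x : dotp (x *m G) (x *m G) = 11 * dotp x x.
Proof.
rewrite dotp_mulmxr trmx_mul (mulmxA G) similarity11_mulT mul_scalar_mx.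
by rewrite -scalemxAr mxE -dotp_mulmx.
Qed.

Local Notation Gbar := (map_mx intr G : 'M['F_11]_8).

Lemma red_similarity11 x : red 11 (x *m G) = red 11 x *m Gbar.
Proof. exact: map_mxM. Qed.

(** Modulo 11, z agrees with some x G, and any 11 y is itself in the image since 11 y = (y G^T)
    G. *)
Lemma red_sub_similarity11 z : (red 11 z <= Gbar)%MS ->
  exists x, z = x *m G.
Proof.
move=> /submxP[c zE]; have [x xE] := red_surj c.
have z0 : red 11 (z - x *m G) = 0.
  by rewrite redB red_similarity11 -xE -zE subrr.
exists (x + divp 11 (z - x *m G) *m G^T).
rewrite mulmxDl -mulmxA similarity11_Tmul mul_mx_scalar.
by rewrite (divpK (isT : prime 11) z0) addrC subrK.
Qed.

Lemma Gbar_isotropic u : (u <= Gbar)%MS -> dotp u u = 0.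
Proof.
move=> /submxP[c ->]; rewrite dotp_mulmxr trmx_mul (mulmxA Gbar) map_trmx -map_mxM.
rewrite similarity11_mulT map_scalar_mx /= mul_scalar_mx.
have -> : 11%:~R = 0 :> 'F_11 by apply/eqP.
by rewrite scale0r mulmx0 mxE.
Qed.

(** Translation by a fixed nonzero e of the row space orthogonal to y acts freely. Such an e exists
    among the combinations of rows 0 and 4: they are independent, and y imposes one linear
    condition. *)
Lemma dvdn_Gbar_hyperplane (y : 'rV['F_11]_8) :
  (11 %| #|[set u : 'rV['F_11]_8 | (u <= Gbar)%MS & dotp y u == 0%R]|)%N.
Proof.
pose r0 := row 0 Gbar; pose r4 := row 4 Gbar.
have [e [e0 eG ye]] : exists e, [/\ e != 0, (e <= Gbar)%MS & dotp y e = 0].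
  have [a [b [ab yab]]] : exists a b,
      (a != 0) || (b != 0) /\ dotp y (a *: r0 + b *: r4) = 0.
    have [y0|y0] := eqVneq (dotp y r0) 0.
      by exists 1, 0; rewrite oner_eq0 !dotpE y0 mulr0 mul0r addr0.
    exists (dotp y r4), (- dotp y r0); rewrite oppr_eq0 y0 orbT; split=> //.
    by rewrite !dotpE; ring.
  exists (a *: r0 + b *: r4); split=> //; last first.
    by rewrite addmx_sub // scalemx_sub // row_sub.
  apply: contraTneq ab => /rowP e0; rewrite negb_or !negbK.
  have := e0 0; have := e0 4; rewrite !mxE /=.
  have -> : (3%:~R : 'F_11) = 3 by [].
  have three0 : 3 != 0 :> 'F_11 by [].
  rewrite !mulr0 addr0 add0r => /eqP; rewrite mulf_eq0 (negPf three0) orbF => ->.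
  by move=> /eqP; rewrite mulf_eq0 (negPf three0) orbF => ->.
apply: (@card_translation_free _ _ (isT : prime 11) _ (fun=> e)) => // v.
rewrite !inE => /andP[vG /eqP yv].
by rewrite addmx_sub // dotpDr yv ye addr0 eqxx.
Qed.

(** The map x |-> x G multiplies norms by 11, and its image consists of the vectors that reduce into
    the row space of [Gbar]. *)
Lemma count_Gbar m :
  count (fun z => red 11 z <= Gbar)%MS (shell 8 (11 ^ 2 * m) (11 ^ 2 * m))
    = rep 8 (11 * m).
Proof.
have G_inj : injective (fun x : 'rV[int]_8 => x *m G).
  move=> x y /(congr1 (mulmx^~ G^T)); rewrite -!mulmxA similarity11_mulT.
  rewrite !mul_mx_scalar => /rowP xy; apply/rowP => i; have := xy i.
  by rewrite !mxE => /mulfI; apply.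
rewrite -size_filter -[RHS](size_map (fun x => x *m G)); apply/perm_size/uniq_perm.
- by rewrite filter_uniq // shell_uniq.
- by rewrite (map_inj_uniq G_inj) shell_uniq.
have normG x : (dotp (x *m G) (x *m G) == (11 ^ 2 * m)%:Z)
    = (dotp x x == (11 * m)%:Z).
  by rewrite dotp_similarity11; apply/eqP/eqP => h; lia.
move=> z; rewrite mem_filter mem_shell //; apply/andP/mapP.
  case=> /red_sub_similarity11[x ->]; rewrite normG => xx.
  by exists x => //; rewrite mem_shell.
case=> x; rewrite mem_shell // => xx ->; rewrite normG xx; split=> //.
by rewrite red_similarity11 submxMl.
Qed.

(** Let V be the nonzero vectors of the row space of [Gbar]. Modulo 11, #|V| and each number of u in
    V orthogonal to y are -1, and p - 1 = -1, so [shell_relation] says that the number of z reducing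
    into V is 0; that number is [rep 8 (11 * m) - rep 8 m]. *)
Lemma rep8_mod11 m : rep 8 (11 * m) = rep 8 m %[mod 11].
Proof.
pose V0 := [set u : 'rV['F_11]_8 | (u <= Gbar)%MS]; pose V := V0 :\ 0.
have V_neq0 : 0 \notin V by rewrite !inE eqxx.
have V_iso u : u \in V -> dotp u u = 0.
  by rewrite !inE => /andP[_]; apply: Gbar_isotropic.
have V_scale c u : c != 0 -> u \in V -> c *: u \in V.
  by move=> c0; rewrite !inE scaler_eq0 negb_or c0 /= => /andP[-> /scalemx_sub ->].
have := shell_relation (isT : (0 < 8 <= 8)%N) (isT : prime 11) isT
  V_neq0 V_iso V_scale m.
have card_y y : (11 %| #|[set u in V | dotp y u == 0%R]| + 1)%N.
  suff <- : #|[set u : 'rV['F_11]_8 | (u <= Gbar)%MS & dotp y u == 0%R]|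
      = (#|[set u in V | dotp y u == 0%R]| + 1)%N by exact: dvdn_Gbar_hyperplane.
  rewrite (cardsD1 0) !inE sub0mx dotp0r eqxx addnC; congr (_ + _)%N.
  by apply: eq_card => u; rewrite !inE andbA.
have -> : #|V| = #|[set u in V | dotp 0 u == 0%R]|.
  by apply: eq_card => u; rewrite [RHS]inE dotp0l eqxx andbT.
have := card_y 0; move: #|_| => k k11.
set s := (\sum_(y <- _) _)%N.
have s11 : (11 %| s + rep 8 m)%N.
  rewrite /rep -sum1_size /s -big_split /=.
  by apply: dvdn_sum => y _; apply: card_y.
set S := shell 8 (11 ^ 2 * m) (11 ^ 2 * m).
have : (count (fun z => red 11 z \in V) S + rep 8 m = rep 8 (11 * m))%N.
  rewrite -(count_red0 8 (isT : prime 11) m) -count_Gbar -/S.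
  rewrite -[RHS]size_filter -(count_predC (fun z => red 11 z == 0)).
  rewrite !count_filter addnC; congr (_ + _)%N.
    apply: eq_count => z /=; case: eqVneq => //= ->.
    by rewrite sub0mx.
  by apply: eq_count => z; rewrite !inE.
move: (count _ _) (rep 8 m) (rep 8 (11 * m)) s11 => c r r'; rewrite /=.
have /dvdnP[t kE] := k11.
have -> : (k * r = 11 * (t * r) - r)%N by rewrite mulnA (mulnC 11) -kE; lia.
have : (r <= 11 * (t * r))%N by rewrite mulnA (mulnC 11) -kE; lia.
move: (t * r)%N => tr; lia.
Qed.

(** * Generating functions *)

Section Gauss.
Variables (R : comPzRingType) (q : R).

Let term n s := (-1) ^+ s * q ^+ (s * n.+1) * \prod_(i < s) (1 + q ^+ i)
  * \prod_(s <= i < n) (1 - q ^+ i.+1).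

(* Shanks-type finite form of Gauss's identity for the sum of (-1)^j q^(j^2);
   the induction on n is a telescoping sum. *)
Lemma gauss_finite n :
  (1 + 2 * \sum_(j < n) (-1) ^+ j.+1 * q ^+ (j.+1 ^ 2)) * \prod_(i < n) (1 + q ^+ i.+1)
  = \sum_(s < n.+1) term n s.
Proof.
elim: n => [|n IH].
  by rewrite !big_ord0 big_ord1 /term mul0n !big_ord0 big_nil !expr0 !mulr1 mulr0 addr0.
(* For s <= n this is [term n s * (1 - q ^+ s)], rewritten so that it also gives the right boundary
   value at s = n + 1. *)
pose h s := if s is s'.+1 then - term n s' * q ^+ n.+1 * (1 + q ^+ s') else 0.
have hE s : (s <= n)%N -> term n s * (1 - q ^+ s) = h s.
  case: s => [|s] sn; first by rewrite expr0 subrr mulr0.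
  rewrite /h /term (big_ltn sn) big_ord_recr /= mulSn exprD exprS.
  set a := q ^+ n.+1; set b := q ^+ (s * _); ring.
have step s : (s <= n)%N ->
    term n.+1 s = (1 + q ^+ n.+1) * term n s + (h s.+1 - h s).
  move=> sn; rewrite -(hE s sn) /h /term big_nat_recr //= mulnS exprD.
  set a := q ^+ n.+1; set b := q ^+ (s * _); ring.
rewrite [RHS]big_ord_recr /= [X in _ = X + _](eq_bigr (fun s : 'I_n.+1 =>
  (1 + q ^+ n.+1) * term n s + (h s.+1 - h s))) => [|s _]; last first.
  exact: (step s (ltn_ord s)).
rewrite big_split /= -mulr_sumr -IH.
rewrite -(big_mkord xpredT (fun s => h s.+1 - h s)) telescope_sumr // subr0.
have D : \prod_(i < n) (1 + q ^+ i) * (1 + q ^+ n) = 2 * \prod_(i < n) (1 + q ^+ i.+1).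
  rewrite -[LHS](big_ord_recr n (fun i : 'I_n.+1 => 1 + q ^+ i)) big_ord_recl /=.
  by rewrite expr0; congr (_ * _).
rewrite /h /term !big_geq // !big_ord_recr /= -mulnn !mulSn !mulnS !exprD !exprS.
move: D; set P := \prod_(i < n) (1 + q ^+ i.+1); set Q := \prod_(i < n) _.
set sg := (-1) ^+ n; set S := \sum_(i < n) _; set c := q ^+ (n * n).
set a := q ^+ n => D.
transitivity ((1 + q * a) * ((1 + 2 * S) * P)
  - sg * (q * a) * (c * a) * (1 + q * a) * (2 * P)); first by ring.
by rewrite -D; ring.
Qed.
End Gauss.

(** * Enumeration of overpartitions by largest part *)

Section Overpartitions.
Local Open Scope nat_scope.
Implicit Types s t : marked_parts.

(** Behind a leading x no copy of x is a first occurrence, so the marking condition on those copies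
    becomes that none is overlined. *)
Lemma overpartition_cons x b s : overpartition ((x, b) :: s) =
  [&& 0 < x, all (fun y => y.1 <= x) s, (x, true) \notin s & overpartition s].
Proof.
rewrite /overpartition /= path_sortedE; last first.
  by move=> y z w; rewrite /geq /= => zy wz; apply: leq_trans wz zy.
rewrite in_cons negb_or eq_sym -lt0n.
have -> : all (geq x) (unzip1 s) = all (fun y => y.1 <= x) s by rewrite all_map.
set F := [forall i, _]; set F' := [forall i, _].
suff -> : F = ((x, true) \notin s) && F'.
  by case: (0 < x); case: (all _ s); case: (_ \notin s); case: (sorted _ _);
     case: (0 \notin _); rewrite ?andbF ?andbT.
apply/forallP/andP => [h|[xs /forallP h] [[|i] ilt]] /=; last first.
- rewrite ltnS in ilt; have := h (Ordinal ilt); rewrite /= in_cons negb_or.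
  case: (nth (0, false) s i) (mem_nth (0, false) ilt) => y [] //= ys ->.
  rewrite andbT; apply: contraNneq xs => <- //.
- by rewrite implybT.
split.
  apply/negP => xs; have ilt : (index (x, true) s).+1 < size ((x, true) :: s).
    by rewrite /= ltnS index_mem.
  have := h (Ordinal ilt); rewrite /= nth_index //= in_cons eqxx //.
apply/forallP => -[i ilt] /=; have := h (Ordinal (ilt : i.+1 < (size s).+1)).
by rewrite /= in_cons negb_or; case: (_.2) => //= /andP[].
Qed.

(** Prepends any number of non-overlined copies of k to the lists given by [a], which divides the
    generating function by 1 - X^k. The argument m is fuel; m >= n suffices for k > 0. *)
Fixpoint unmarked_copies (k : nat) (a : nat -> seq marked_parts) (m n : nat) :=
  a n ++ (if m is m'.+1 then
            if k <= n then [seq (k, false) :: s | s <- unmarked_copies k a m' (n - k)]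
            else [::]
          else [::]).

(** The leading k is overlined or not, whence a factor (1 + X^k)/(1 - X^k) for each k. *)
Fixpoint overpartitions (k : nat) : nat -> seq marked_parts :=
  if k is k'.+1 then fun n =>
    unmarked_copies k (overpartitions k') n n ++
    (if k <= n then
       [seq (k, true) :: s | s <- unmarked_copies k (overpartitions k') (n - k) (n - k)]
     else [::])
  else fun n => if n == 0 then [:: [::]] else [::].

Lemma unmarked_copies_fuel k a m n : 0 < k -> n <= m ->
  unmarked_copies k a m n = unmarked_copies k a n n.
Proof.
move=> k0; elim/ltn_ind: n m => n IH m nm.
case: n m nm IH => [|n] [|m] //= nm IH; first by rewrite leqNgt k0.
case: ifP => // kn; rewrite (IH (n.+1 - k) _ m) ?(IH (n.+1 - k) _ n) //; lia.
Qed.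

Definition parts_le k s := all (fun y : nat * bool => y.1 <= k) s.

Lemma parts_leW k k' s : k <= k' -> parts_le k s -> parts_le k' s.
Proof. by move=> kk; apply: sub_all => y yk; apply: leq_trans yk kk. Qed.

Lemma weight_cons x b s : weight ((x, b) :: s) = x + weight s.
Proof. by []. Qed.

Section Step.
Variables (k : nat) (a : nat -> seq marked_parts).
Hypotheses (a_uniq : forall n, uniq (a n))
  (mem_a : forall n s, (s \in a n) =
     [&& overpartition s, weight s == n & parts_le k s]).
Let b n := unmarked_copies k.+1 a n n.

Lemma unmarked_copiesE n :
  b n = a n ++ (if k < n then [seq (k.+1, false) :: s | s <- b (n - k.+1)] else [::]).
Proof.
rewrite /b; case: n => [|n]; first by rewrite /=.
by rewrite [LHS]/=; case: ifP => // kn; rewrite unmarked_copies_fuel //; lia.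
Qed.

Lemma mem_unmarked_copies n s : (s \in b n) =
  [&& overpartition s, weight s == n, parts_le k.+1 s & (k.+1, true) \notin s].
Proof.
elim/ltn_ind: n s => n IH s.
rewrite unmarked_copiesE mem_cat mem_a.
have aP : parts_le k s -> parts_le k.+1 s && ((k.+1, true) \notin s).
  move=> sk; rewrite (parts_leW _ sk) //; apply/negP => /(allP sk) /=.
  by rewrite ltnn.
apply/orP/and4P => [[/and3P[so sn /aP/andP[]] //|]|[so sn sk ks]].
  case: ifP => // kn /mapP[t]; rewrite IH; last lia.
  case/and4P => t_o /eqP tn tk kt ->; split.
  - by rewrite overpartition_cons; apply/and4P; split.
  - by rewrite weight_cons tn subnKC.
  - by rewrite /parts_le /= leqnn.
  - by rewrite in_cons negb_or kt xpair_eqE andbF.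
case: s so sn sk ks {aP} => [|[x c] t] so sn sk ks; first by left; rewrite sn so.
have [xk|xk] := leqP x k.
  left; rewrite so sn /= /parts_le /= xk /=.
  move: so; rewrite overpartition_cons => /and4P[_ tx _ _].
  by apply: sub_all tx => y yx; apply: leq_trans yx xk.
right; move: sk; rewrite /parts_le /= => /andP[xk' tk].
have xE : x = k.+1 by apply/eqP; rewrite eqn_leq xk'.
move: so sn ks; rewrite {}xE overpartition_cons weight_cons in_cons negb_or.
move=> /and4P[_ _ _ t_o] /eqP tn /andP[cN kt].
have -> : c = false by case: c cN; rewrite // eqxx.
rewrite -tn leq_addr addKn; apply: map_f.
by rewrite IH ?eqxx ?t_o ?kt ?andbT //; lia.
Qed.

Lemma unmarked_copies_uniq n : uniq (b n).
Proof.
elim/ltn_ind: n => n IH; rewrite unmarked_copiesE.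
case: ifP => kn; last by rewrite cats0.
have inj (c : bool) : injective (cons (k.+1, c)) by move=> s t [].
rewrite cat_uniq a_uniq (map_inj_uniq (inj false)) IH ?andbT /=; last lia.
apply/hasPn => s /mapP[t _ ->]; rewrite /= mem_a.
by apply/negP => /and3P[_ _]; rewrite /parts_le /= ltnn.
Qed.

Lemma marked_uniq n :
  uniq (b n ++ (if k < n then [seq (k.+1, true) :: s | s <- b (n - k.+1)] else [::])).
Proof.
case: ifP => kn; last by rewrite cats0 unmarked_copies_uniq.
have inj (c : bool) : injective (cons (k.+1, c)) by move=> s t [].
rewrite cat_uniq (map_inj_uniq (inj true)) !unmarked_copies_uniq ?andbT /=.
apply/hasPn => s /mapP[t _ ->]; rewrite /= mem_unmarked_copies.
by apply/negP => /and4P[_ _ _]; rewrite in_cons eqxx.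
Qed.

Lemma mem_marked n s :
  (s \in b n ++ (if k < n then [seq (k.+1, true) :: s | s <- b (n - k.+1)] else [::]))
  = [&& overpartition s, weight s == n & parts_le k.+1 s].
Proof.
rewrite mem_cat mem_unmarked_copies; apply/orP/and3P.
  case=> [/and4P[] //|]; case: ifP => // kn /mapP[t].
  rewrite mem_unmarked_copies => /and4P[t_o /eqP tn tk kt] ->; split.
  - by rewrite overpartition_cons; apply/and4P; split.
  - by rewrite weight_cons tn subnKC.
  - by rewrite /parts_le /= leqnn.
case: s => [|[x c] t] [so sn sk]; first by left; rewrite so sn.
have [ks|ks] := boolP ((k.+1, true) \in (x, c) :: t); last by left; rewrite so sn sk.
right; move: so sn sk ks.
rewrite overpartition_cons weight_cons in_cons /parts_le /=.
move=> /and4P[_ tx xt t_o] /eqP tn /andP[xk tk] ks.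
have xE : x = k.+1.
  apply/eqP; rewrite eqn_leq xk /=.
  by case/orP: ks => [/eqP[<-] //|/(allP tx)].
move: xt tn ks; rewrite {}xE => xt tn; rewrite (negPf xt) orbF => /eqP[<-].
rewrite -tn leq_addr addKn; apply: map_f.
by rewrite mem_unmarked_copies t_o eqxx xt andbT.
Qed.
End Step.

Lemma overpartitionsP k :
  (forall n, uniq (overpartitions k n)) /\
  (forall n s, (s \in overpartitions k n) =
     [&& overpartition s, weight s == n & parts_le k s]).
Proof.
elim: k => [|k [IHu IHm]]; split=> n.
- by rewrite /=; case: ifP.
- move=> s; rewrite /=; apply/idP/and3P.
    by case: eqP => // ->; rewrite inE => /eqP ->; split=> //; apply/and3P; split=> //;
      apply/forallP => -[].
  case: s => [|[x c] t] [so sn sk]; first by rewrite eq_sym in sn; rewrite sn.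
  by move: so sk; rewrite overpartition_cons /parts_le /= => /andP[x0 _]; rewrite leqNgt x0.
- exact: marked_uniq.
- by move=> s; apply: mem_marked.
Qed.
End Overpartitions.

(** * Truncated power series, the overpartition series and theta *)

Section Series.
Variable R : comNzRingType.
Implicit Types f g : {poly R}.

(** Congruence modulo X^N, so that polynomials can stand for power series. *)
Definition eq_upto N f g := forall i, (i < N)%N -> f`_i = g`_i.

Lemma eq_upto_refl N f : eq_upto N f f.
Proof. by []. Qed.

Lemma eq_upto_sym N f g : eq_upto N f g -> eq_upto N g f.
Proof. by move=> fg i iN; rewrite fg. Qed.

Lemma eq_upto_trans N f g h : eq_upto N f g -> eq_upto N g h -> eq_upto N f h.
Proof. by move=> fg gh i iN; rewrite fg ?gh. Qed.

Lemma eq_uptoM N f f' g g' :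
  eq_upto N f f' -> eq_upto N g g' -> eq_upto N (f * g) (f' * g').
Proof.
move=> ff gg i iN; rewrite !coefM; apply: eq_bigr => j _.
by rewrite ff ?gg //; have := ltn_ord j; lia.
Qed.

Lemma eq_uptoX N f g k : eq_upto N f g -> eq_upto N (f ^+ k) (g ^+ k).
Proof.
by move=> fg; elim: k => // k IH; rewrite !exprS; apply: eq_uptoM.
Qed.

(** A constant coefficient 1 makes d invertible as a power series; the coefficients are compared one
    after another. *)
Lemma eq_upto_cancel N (d f g : {poly R}) : d`_0 = 1 ->
  eq_upto N (d * f) (d * g) -> eq_upto N f g.
Proof.
move=> d0 dfg; elim/ltn_ind => i IH iN; have := dfg i iN.
rewrite !coefM !big_ord_recl /= d0 !mul1r !subn0.
rewrite [X in _ + X = _](eq_bigr (fun j : 'I_i => d`_(bump 0 j) * g`_(i - bump 0 j))).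
  by move/addIr.
by move=> j _; rewrite IH //; rewrite /bump; have := ltn_ord j; lia.
Qed.

Definition trunc_series N (c : nat -> nat) : {poly R} := \poly_(i < N) (c i)%:R.

Lemma trunc_series_shift N k c c' c'' :
  (forall n, c n = c' n + (if k <= n then c'' (n - k) else 0))%N ->
  eq_upto N (trunc_series N c) (trunc_series N c' + 'X^k * trunc_series N c'').
Proof.
move=> cE i iN; rewrite coefD coefXnM !coef_poly iN cE natrD.
by case: ltnP => ki; rewrite ?addr0 //; case: ifP => //; lia.
Qed.

Definition op_series N k := trunc_series N (fun n => size (overpartitions k n)).

(** Let B count the lists in which no k+1 is overlined. Then B (1 - X^(k+1)) is the series for k,
    and B (1 + X^(k+1)) is the series for k+1. *)
Lemma op_series_step N k :
  eq_upto N (op_series N k.+1 * (1 - 'X^(k.+1))) (op_series N k * (1 + 'X^(k.+1))).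
Proof.
have [a_uniq mem_a] := overpartitionsP k.
pose b n := unmarked_copies k.+1 (overpartitions k) n n.
pose B := trunc_series N (fun n => size (b n)).
have stepB : eq_upto N B (op_series N k + 'X^(k.+1) * B).
  apply: (@trunc_series_shift _ _ (fun n => size (b n))
    (fun n => size (overpartitions k n)) (fun n => size (b n))) => n; rewrite {1}/b unmarked_copiesE size_cat.
  by case: ifP => // _; rewrite size_map.
have stepA : eq_upto N (op_series N k.+1) (B + 'X^(k.+1) * B).
  apply: (@trunc_series_shift _ _ (fun n => size (overpartitions k.+1 n))
    (fun n => size (b n)) (fun n => size (b n))) => n; rewrite /= size_cat.
  by case: ifP => // _; rewrite size_map.
apply: (eq_upto_trans (eq_uptoM stepA (@eq_upto_refl _ _))) => i iN.
rewrite [op_series N k * _]mulrC.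
have -> : (B + 'X^(k.+1) * B) * (1 - 'X^(k.+1))
  = (1 + 'X^(k.+1)) * (B - 'X^(k.+1) * B) by ring.
apply: (eq_uptoM (@eq_upto_refl _ _)) iN => j jN.
by rewrite coefB [in LHS]stepB // coefD addrK.
Qed.

Lemma op_series_prod N k :
  eq_upto N (op_series N k * \prod_(i < k) (1 - 'X^(i.+1)))
            (\prod_(i < k) (1 + 'X^(i.+1))).
Proof.
elim: k => [|k IH] i iN.
  rewrite !big_ord0 mulr1 coef1 coef_poly iN /=.
  by case: i {iN}.
rewrite !big_ord_recr /=; set P := \prod_(i < k) (1 - 'X^(i.+1)).
have -> : op_series N k.+1 * (P * (1 - 'X^(k.+1)))
  = P * (op_series N k.+1 * (1 - 'X^(k.+1))) by ring.
rewrite (eq_uptoM (@eq_upto_refl N P) (@op_series_step N k)) // mulrA.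
by apply: eq_uptoM iN => // j jN; rewrite mulrC IH.
Qed.

(** The truncation of phi(-q) to exponents j^2 with |j| <= N; the sign is right because j^2 and j
    have the same parity. *)
Definition theta N : {poly R} := \sum_(j < N.*2.+1) (- 'X) ^+ (absz (j%:Z - N%:Z) ^ 2).

Lemma thetaE N :
  theta N = 1 + 2 * \sum_(j < N) (-1) ^+ j.+1 * 'X ^+ (j.+1 ^ 2).
Proof.
pose F j : {poly R} := (- 'X) ^+ (j ^ 2).
have FE j : F j = (-1) ^+ j * 'X ^+ (j ^ 2).
  by rewrite /F [LHS]exprNn -[(-1) ^+ (j ^ 2)]signr_odd oddX /= signr_odd.
rewrite -(eq_bigr _ (fun j _ => FE _)) mulr_natl mulr2n addrA.
rewrite /theta -(big_mkord xpredT (fun j => F (absz (j%:Z - N%:Z)))).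
rewrite (@big_cat_nat _ _ _ N) //=; last lia.
rewrite [X in _ + X]big_ltn; last lia.
have -> : F (absz (N%:Z - N%:Z)) = 1 by rewrite subrr /F expr0.
rewrite addrA [_ + 1]addrC; congr (_ + _ + _).
  rewrite big_nat_rev /= big_mkord; apply: eq_bigr => j _; congr F.
  by have := ltn_ord j; lia.
rewrite -{1}[N.+1]add0n big_addn (_ : (_ - _)%N = N); last lia.
by rewrite big_mkord; apply: eq_bigr => j _; congr F; lia.
Qed.

(** In [gauss_finite] the term s = 0 is the product of the 1 - X^i and all others are divisible by
    X^(N+1). Combining with [op_series_prod] and cancelling the product of the 1 + X^i gives the
    claim. *)
Lemma op_series_theta N : eq_upto N.+1 (op_series N.+1 N * theta N) 1.
Proof.
have D0 : (\prod_(i < N) (1 + 'X^(i.+1)) : {poly R})`_0 = 1.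
  rewrite -horner_coef0 horner_prod big1 // => i _.
  by rewrite hornerD hornerXn hornerC expr0n addr0.
apply: (eq_upto_cancel D0).
have gauss : eq_upto N.+1 (theta N * \prod_(i < N) (1 + 'X^(i.+1)))
    (\prod_(i < N) (1 - 'X^(i.+1))).
  move=> i iN; rewrite thetaE gauss_finite big_ord_recl.
  rewrite big_mkord mul0n big_ord0 !expr0 !mul1r coefD.
  rewrite [X in _ + X](_ : _ = 0) ?addr0 // coef_sum big1 // => s _.
  rewrite /bump /= mulSn exprD -!mulrA mulrCA.
  by rewrite coefXnM iN.
rewrite mulr1 mulrC -mulrA.
apply: eq_upto_trans (@op_series_prod N.+1 N).
exact: eq_uptoM (@eq_upto_refl _ _) gauss.
Qed.

(** The expanded product has one monomial (-X)^(z.z) for each vector z of the box, and the box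
    contains all vectors of norm m <= N. *)
Lemma coef_theta_pow N k m : (m <= N)%N ->
  (theta N ^+ k)`_m = (-1) ^+ m * (rep k m)%:R.
Proof.
move=> mN.
have -> : theta N ^+ k = \prod_(i < k) theta N by rewrite prodr_const card_ord.
rewrite /theta bigA_distr_bigA /= coef_sum.
rewrite (eq_bigr (fun f : {ffun 'I_k -> 'I_(N.*2.+1)} =>
  (-1) ^+ m *+ (dotp (box_vec f) (box_vec f) == m%:Z))) => [|f _]; last first.
  rewrite prodrXr [(- 'X) ^+ _]exprNn.
  have -> : dotp (box_vec f) (box_vec f)
      = (\sum_(i < k) absz ((f i)%:Z - N%:Z) ^ 2)%N%:Z.
    rewrite /dotp (big_morph Posz PoszD (erefl 0%:Z)); apply: eq_bigr => i _.
    by rewrite mxE -mulnn PoszM abszE -normrM ger0_norm // -expr2 sqr_ge0.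
  set e := (\sum_(i < k) _)%N.
  have -> : (-1 : {poly R}) ^+ e = ((-1) ^+ e)%:P by rewrite rmorphXn rmorphN1.
  rewrite coefCM coefXn eqz_nat eq_sym.
  by case: eqP => [->|]; rewrite ?mulr0 // mulr1.
rewrite (repE _ mN) /shell size_filter count_map -sum1_count natr_sum mulr_sumr.
rewrite [RHS]big_mkcond /= big_enum /=; apply: eq_bigr => f _.
by case: ifP; rewrite ?mulr1.
Qed.
End Series.

(** * Overpartition triples as coefficients of a cube *)

Section Pbar3.
Variables (R : comNzRingType) (N : nat).

Let U m := flatten [seq overpartitions N i | i <- iota 0 m].

Let mem_U m s : (s \in U m) = [&& overpartition s, (weight s < m)%N & parts_le N s].
Proof.
have [_ mem_op] := overpartitionsP N.
apply/flattenP/and3P => [[l /mapP[i]]|[so sm sN]].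
  rewrite mem_iota add0n => im ->; rewrite mem_op => /and3P[so /eqP -> sN].
  by [].
exists (overpartitions N (weight s)); last by rewrite mem_op so eqxx.
by apply: map_f; rewrite mem_iota.
Qed.

Let U_uniq m : uniq (U m).
Proof.
have [op_uniq mem_op] := overpartitionsP N.
elim: m => // m IH; rewrite /U -addn1 iotaD map_cat flatten_cat cat_uniq IH /=.
rewrite cats0 op_uniq andbT; apply/hasPn => s; rewrite mem_op => /and3P[_ /eqP sm _].
by rewrite -/(U m) mem_U sm ltnn andbF.
Qed.

Let op_seriesE :
  op_series R N.+1 N = \sum_(s <- U N.+1) 'X^(weight s).
Proof.
have [_ mem_op] := overpartitionsP N.
rewrite /op_series /trunc_series poly_def big_flatten big_map.
rewrite -[iota 0 N.+1]/(index_iota 0 N.+1) big_mkord; apply: eq_bigr => i _.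
rewrite big_seq (eq_bigr (fun=> 'X^i)) => [|s]; last first.
  by rewrite mem_op => /and3P[_ /eqP ->].
by rewrite -big_seq big_const_seq count_predT iter_addr_0 scaler_nat.
Qed.

Lemma pbar3_coef : (op_series R N.+1 N ^+ 3)`_N = (pbar3 N)%:R.
Proof.
pose T := [seq (x, c) | x <- [seq (a, b) | a <- U N.+1, b <- U N.+1], c <- U N.+1].
pose w (t : marked_parts * marked_parts * marked_parts) :=
  (weight t.1.1 + weight t.1.2 + weight t.2)%N.
have T_uniq : uniq T.
  by rewrite !allpairs_uniq //; move=> [? ?] [? ?].
have powE : op_series R N.+1 N ^+ 3 = \sum_(t <- T) 'X^(w t).
  rewrite /T !big_allpairs /= !exprSr expr0 mul1r op_seriesE big_distrlr /=.
  rewrite mulr_suml; apply: eq_bigr => a _; rewrite mulr_suml; apply: eq_bigr => b _.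
  by rewrite mulr_sumr; apply: eq_bigr => c _; rewrite /w /= !exprD.
rewrite (@pbar3_enum N [seq t <- T | w t == N]).
- rewrite size_filter -sum1_count natr_sum powE coef_sum [RHS]big_mkcond.
  by apply: eq_bigr => t _; rewrite coefXn [in LHS]eq_sym; case: eqP.
- by rewrite filter_uniq.
move=> [[a b] c]; rewrite mem_filter /overpartition_triple /w /=.
have mem_U' s : (weight s <= N)%N -> (s \in U N.+1) = overpartition s.
  move=> sN; rewrite mem_U ltnS sN /=; apply: andb_idr => /and3P[_ s0 _].
  apply/allP => y ys; apply: leq_trans sN; apply: mem_le_sumn.
  exact: (map_f fst ys).
rewrite /T; apply/andP/and4P => [[abc]|[ao bo co abc]]; last first.
  have N3 := eqP abc; split=> //.
  apply/allpairsP; exists ((a, b), c); rewrite /= mem_U' ?co; last lia.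
  split=> //; apply/allpairsP; exists (a, b) => /=.
  by rewrite !mem_U' ?ao ?bo //; lia.
case/allpairsP=> -[x d] /= [/allpairsP[[a' b'] /= [aU bU ->]] cU] E.
move: abc; case: E => -> -> -> abc.
by move: aU bU cU; rewrite !mem_U => /andP[-> _] /andP[-> _] /andP[-> _].
Qed.
End Pbar3.

Lemma op_series_Frobenius N (c : nat -> nat) :
  (trunc_series 'F_11 N c) ^+ 11 = \sum_(i < N) (c i)%:R *: 'X^(11 * i).
Proof.
have ch : 11 \in [pchar {poly 'F_11}] by rewrite pchar_poly; apply: pchar_Fp.
rewrite /trunc_series poly_def -(pFrobenius_autE ch) rmorph_sum /=.
apply: eq_bigr => i _; rewrite scaler_nat pFrobenius_autMn pFrobenius_autE.
by rewrite -exprM mulnC scaler_nat.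
Qed.

Lemma signr_Fp_nat (m : nat) : (-1) ^+ (11 * m) = (-1) ^+ m :> 'F_11.
Proof. by rewrite -signr_odd oddM /= signr_odd. Qed.

Lemma natr_F11_eq m n : (m%:R == n%:R :> 'F_11) = (m == n %[mod 11]).
Proof. by rewrite -val_eqE /= !val_Fp_nat. Qed.

(** With A the overpartition series and S = theta, A S = 1 gives A^3 = A^11 S^8. By Frobenius A^11
    is A evaluated at X^11, and the coefficients of S^8 at 11m and m agree by [rep8_mod11]. So the
    coefficient at 11n is that of A S^8 = S^7 at n. *)
Lemma pbar3_rep7 n : (pbar3 (11 * n))%:R = (-1) ^+ n * (rep 7 n)%:R :> 'F_11.
Proof.
set N := (11 * n)%N.
pose A : {poly 'F_11} := op_series 'F_11 N.+1 N.
pose S : {poly 'F_11} := theta 'F_11 N.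
have AS : eq_upto N.+1 (A * S) 1 by apply: op_series_theta.
have A3 : eq_upto N.+1 (A ^+ 3) (A ^+ 11 * S ^+ 8).
  have := eq_uptoM (@eq_upto_refl _ N.+1 (A ^+ 3)) (eq_uptoX 8 (eq_upto_sym AS)).
  by rewrite expr1n mulr1 exprMn [X in eq_upto _ _ X]mulrA -(exprD A 3 8).
have S8 m : (m <= n)%N -> (S ^+ 8)`_(11 * m) = (S ^+ 8)`_m.
  move=> mn; rewrite !coef_theta_pow ?leq_mul2l /N //; last lia.
  rewrite signr_Fp_nat; congr (_ * _); apply/eqP.
  by rewrite natr_F11_eq rep8_mod11.
rewrite -pbar3_coef A3 // op_series_Frobenius mulr_suml coef_sum.
have -> : (-1) ^+ n * (rep 7 n)%:R = (A * S ^+ 8)`_n.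
  rewrite -(coef_theta_pow 'F_11 7 (_ : n <= N)%N); last by rewrite /N; lia.
  rewrite -[S ^+ 7]mul1r [S ^+ 8]exprS [A * _]mulrA; apply: (@eq_uptoM _ N.+1) => //.
    exact: (eq_upto_sym AS).
  by rewrite /N; lia.
rewrite coefM (big_ord_widen N.+1 (fun i => A`_i * (S ^+ 8)`_(n - i))); last first.
  by rewrite /N; lia.
rewrite [RHS]big_mkcond /=; apply: eq_bigr => i _.
rewrite -scalerAl coefZ coefXnM ltn_pmul2l // ltnS.
case: ltnP => ni; first by rewrite mulr0.
by rewrite -mulnBr S8 ?leq_subr // coef_poly ltn_ord.
Qed.

Lemma pbar3_eq_mod m n : odd m = odd n -> rep 7 m = rep 7 n %[mod 11] ->
  pbar3 (11 * m) = pbar3 (11 * n) %[mod 11].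
Proof.
move=> mn /eqP; rewrite -natr_F11_eq => /eqP r.
by apply/eqP; rewrite -natr_F11_eq !pbar3_rep7 r -signr_odd mn signr_odd.
Qed.

Lemma pbar3_eq0_mod n : (rep 7 n)%:R = 0 :> 'F_11 -> pbar3 (11 * n) = 0 %[mod 11].
Proof. by move=> r; apply/eqP; rewrite -natr_F11_eq pbar3_rep7 r mulr0. Qed.

(** * The recurrence along odd powers of p *)

Section PrimePowers.
Variables (p N : nat).
Hypotheses (p_prime : prime p) (p_odd : odd p) (coprime_N_p : coprime N p).

(** Odd exponents ensure that p divides the argument, as the Hecke relations require, and steps by
    p^2 preserve this. *)
Let a k : 'F_11 := (rep 7 (p ^ (2 * k + 1) * N))%:R.

Let a_step k : a k.+2 = (1 + p%:R ^+ 5) * a k.+1 - p%:R ^+ 5 * a k.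
Proof.
have pk : (p %| p ^ (2 * k + 1) * N)%N by rewrite addn1 expnS -mulnA dvdn_mulr.
have := rep_hecke2 (isT : (0 < 7 <= 8)%N) p_prime p_odd (isT : (1 < 7)%N) pk.
move=> /(congr1 (fun m => m%:R : 'F_11)).
rewrite -[7.-2]/5%N natrD natrM natrX natrM natrD natrX /a => E.
rewrite (_ : (2 * k.+2 + 1 = 2 + (2 + (2 * k + 1)))%N); last lia.
rewrite (_ : (2 * k.+1 + 1 = 2 + (2 * k + 1))%N); last lia.
rewrite [(p ^ (2 + (2 + _)))%N]expnD [(p ^ (2 + (2 * k + 1)))%N]expnD.
rewrite -(mulnA (p ^ 2)%N (p ^ 2 * _)%N) -(mulnA (p ^ 2)%N (p ^ (2 * k + 1))%N).
by rewrite -E addrK.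
Qed.

Let a_1 : a 1 = (1 + p%:R ^+ 5) * a 0.
Proof.
have N_p : ~~ (p %| N)%N by rewrite -prime_coprime // coprime_sym.
have p0 := prime_gt0 p_prime.
have pN : (p %| p * N)%N by rewrite dvdn_mulr.
have p2N : ~~ (p ^ 2 %| p * N)%N by rewrite -mulnn dvdn_pmul2l.
have := rep_hecke1 (isT : (0 < 7 <= 8)%N) p_prime p_odd (isT : (1 < 7)%N) pN p2N.
rewrite mulnA -expnSr /a => ->.
by rewrite natrM natrD natrX muln0 add0n expn1.
Qed.

(** The recurrence becomes a_{k+2} = 2 a_{k+1} - a_k with a_1 = 2 a_0, so a_k = (k+1) a_0, which
    vanishes at k = 11 alpha + 10. *)
Lemma rep7_residue alpha : p%:R ^+ 5 = 1 :> 'F_11 ->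
  (rep 7 (p ^ (22 * alpha + 21) * N))%:R = 0 :> 'F_11.
Proof.
move=> p5; have aE k : a k = k.+1%:R * a 0 /\ a k.+1 = k.+2%:R * a 0.
  elim: k => [|k [IH1 IH2]]; first by rewrite a_1 p5 mul1r.
  split=> //; rewrite a_step p5 IH1 IH2 !mulrSr.
  by ring.
have [] := aE (11 * alpha + 10)%N; rewrite /a.
rewrite (_ : (2 * (11 * alpha + 10) + 1 = 22 * alpha + 21)%N); last lia.
move=> -> _; rewrite (_ : (11 * alpha + 10).+1 = (11 * alpha.+1)%N); last lia.
by rewrite natrM pchar_Fp_0 // !mul0r.
Qed.

(** Here a_1 = 0 and a_{k+2} = a_k, so all terms of odd index vanish. *)
Lemma rep7_nonresidue alpha : p%:R ^+ 5 = -1 :> 'F_11 ->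
  (rep 7 (p ^ (4 * alpha + 3) * N))%:R = 0 :> 'F_11.
Proof.
move=> p5; have aE k : a (2 * k + 1) = 0.
  elim: k => [|k IH]; first by rewrite a_1 p5 subrr mul0r.
  rewrite (_ : (2 * k.+1 + 1 = (2 * k + 1).+2)%N); last lia.
  by rewrite a_step p5 subrr mul0r add0r mulN1r opprK.
have := aE alpha; rewrite /a.
by rewrite (_ : (2 * (2 * alpha + 1) + 1 = 4 * alpha + 3)%N) //; lia.
Qed.
End PrimePowers.

Local Open Scope nat_scope.

Theorem theorem4p8 (p N alpha : nat) (p_prime : prime p) (p_ge3 : 3 <= p)
    (N_gt0 : 0 < N) (coprime_N_p : coprime N p) :
  [/\ forall n : nat, pbar3 (11 ^ 3 * n) = pbar3 (11 * n) %[mod 11],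
      p %% 11 \in [:: 1; 3; 4; 5; 9] ->
        pbar3 (11 * p ^ (22 * alpha + 21) * N) = 0 %[mod 11]
    & p %% 11 \in [:: 2; 6; 7; 8; 10] ->
        pbar3 (11 * p ^ (4 * alpha + 3) * N) = 0 %[mod 11]].
Proof.
have p_odd : odd p by case: (even_prime p_prime) p_ge3 => // ->.
have pE : (p%:R = (p %% 11)%:R :> 'F_11)%R.
  by apply/eqP; rewrite natr_F11_eq modn_mod.
split=> [n||].
- rewrite (_ : 11 ^ 3 * n = 11 * (11 ^ 2 * n)); last by rewrite mulnA -expnS.
  by apply: pbar3_eq_mod; [rewrite oddM | apply: rep7_mod11].
- move=> pr; rewrite -mulnA; apply: pbar3_eq0_mod; apply: rep7_residue => //.
  (* Euler's criterion, checked class by class: the squares modulo 11 have fifth power 1, and the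
     non-squares treated next have fifth power -1. *)
  by rewrite pE; move: pr; rewrite !inE => /orP[|/or4P[]] /eqP ->; apply/eqP.
move=> pr; rewrite -mulnA; apply: pbar3_eq0_mod; apply: rep7_nonresidue => //.
by rewrite pE; move: pr; rewrite !inE => /orP[|/or4P[]] /eqP ->; apply/eqP.
Qed.
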